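(* There exists a constant $C>0$ such that, for any integer $n\ge 16$ and any $\delta\in(0,1/e]$, $$\sup_{x_1,\dots,x_n\in\mathbb R^2}\ \sup_{\theta^\star\in\mathbb R^2}\ \mathsf Q_{1-\delta}\Big(\Lambda_n^{\log}(\theta^\star;x_{1:n};Y_{1:n})\Big)\le C\Big(\log\log\log n+\log\frac1\delta\Big).$$
   Context: $\sigma(t)=1/(1+e^{-t})$. For deterministic $x_1,\dots,x_n\in\mathbb R^2$ and $\theta^\star\in\mathbb R^2$, the labels $Y_1,\dots,Y_n\in\{-1,1\}$ are independent with $\mathbf P(Y_i=1)=\sigma(\langle x_i,\theta^\star\rangle)$, and $$\Lambda_n^{\log}(\theta^\star;x_{1:n};Y_{1:n})=\log\frac{\sup_{\theta\in\mathbb R^2}\prod_{i=1}^n\sigma(Y_i\langle x_i,\theta\rangle)}{\prod_{i=1}^n\sigma(Y_i\langle x_i,\theta^\star\rangle)}.$$ For a real random variable $Z$, $\mathsf Q_{1-\delta}(Z)=\inf\{z\in\mathbb R:\mathbf P(Z\le z)\ge 1-\delta\}$; here the randomness is over $Y_{1:n}$. All logarithms are natural. *)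

(* Defs.v *)
From HB Require Import structures.
From mathcomp Require Import all_boot all_order all_algebra.
From mathcomp Require Import all_classical all_reals all_analysis.
Set Implicit Arguments.
Unset Strict Implicit.
Unset Printing Implicit Defensive.
Import Order.TTheory GRing.Theory Num.Theory.
Import numFieldNormedType.Exports.
Local Open Scope classical_set_scope.
Local Open Scope ring_scope.

Definition sigmoid (R : realType) (t : R) : R := (1 + expR (- t))^-1.

Definition dot (R : realType) (k : nat) (u v : 'rV[R]_k) : R :=
  \sum_(j < k) u ord0 j * v ord0 j.

Definition logistic_likelihood (R : realType) (n : nat)
    (x : 'I_n -> 'rV[R]_2) (y : 'I_n -> R) (theta : 'rV[R]_2) : R :=
  \prod_(i < n) sigmoid (y i * dot (x i) theta).

(* The likelihoods lie in ]0, 1], so the real-valued [sup] below is a genuine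
   supremum and the logarithm is taken at a positive real. *)
Definition log_likelihood_ratio (R : realType) (n : nat)
    (theta_star : 'rV[R]_2) (x : 'I_n -> 'rV[R]_2) (y : 'I_n -> R) : R :=
  ln (sup (range (logistic_likelihood x y)) /
      logistic_likelihood x y theta_star).

(* [quantile P p Z] is taken in the extended reals, so that no junk value is
   attached to the infimum of an empty or unbounded set. *)
Definition quantile (R : realType) (d : measure_display)
    (T : measurableType d) (P : probability T R) (p : R) (Z : T -> R) : \bar R :=
  ereal_inf [set z%:E | z in [set z : R | (p%:E <= P [set w | (Z w <= z)%R])%E]].

Definition mutually_independent (R : realType) (d : measure_display)
    (T : measurableType d) (P : probability T R) (I : finType)
    (X : I -> T -> R) : Prop :=
  forall (J : {set I}) (A : I -> set R),
    (forall i, measurable (A i)) ->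
    P (\bigcap_(i in [set` J]) (X i @^-1` A i)) =
      (\prod_(i in J) P (X i @^-1` A i))%E.

Definition logistic_labels (R : realType) (d : measure_display)
    (T : measurableType d) (P : probability T R) (n : nat)
    (x : 'I_n -> 'rV[R]_2) (theta_star : 'rV[R]_2) (Y : 'I_n -> T -> R) : Prop :=
  [/\ forall i w, Y i w = -1 \/ Y i w = 1,
      mutually_independent P Y
    & forall i, P [set w | Y i w = 1] = (sigmoid (dot (x i) theta_star))%:E].

(* Main.v *)
Require Import Defs.
From HB Require Import structures.
From mathcomp Require Import all_boot all_order all_algebra.
From mathcomp Require Import all_classical all_reals all_analysis.
From mathcomp Require Import fintype finset zify ring lra.
Set Implicit Arguments.
Unset Strict Implicit.
Unset Printing Implicit Defensive.
Import Order.TTheory GRing.Theory Num.Theory.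
Local Open Scope ring_scope.

(* Let [F i] record whether label [i] takes its less likely value: an
   independent flip of probability [1 / (1 + expR m)], where
   [m = |<x_i, theta_star>|].  The log-likelihood gain of [theta] is
   [\sum_i (F i * b i - cgf (p i) (b i))] with [b i] linear in a point [w] of the
   plane.  At a fixed [w] it exceeds [t] with probability at most [expR (- t)];
   the point is a union bound over [w] that loses only a factor [expR (c * z)],
   with a small [c], once [z] dominates [ln ln ln n].

   Halving [w] turns a gain [g] into [g / 2 + J], where [J] is the total Jensen
   gap of the cumulants at [w]; so a gain at least [z] somewhere forces one at a
   point with [J < z].  There only few or light indices can be saturated, that
   is, have [b i] so large in absolute value that [F i] is almost determined.
   Up to a set of tiny mass the saturated set depends only on the side of [w]
   relative to [O(z + K * expR (c * z))] lines, hence takes polynomially many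
   values, [K] being the number of dyadic levels of [m] below [ln n + z].  For a
   given saturated set either a flip disagrees with its prediction, and then the
   saturated gain is nonpositive, or all agree, which has probability
   [expR (- entropy)] with the entropy bounding the saturated gain.  On the
   other indices the centered cumulant is [O(z)] times its gap, and a grid of
   [O(z ^ 2)] points suffices.  As [K = O(ln (ln n + z))], the requirement
   [K <= expR (c * z)] is what produces [ln ln ln n]. *)

(** * Cumulants of centered Bernoulli variables and their Jensen gaps *)

Section Cumulant.
Variable R : realType.
Implicit Types p b s t x y A : R.

Lemma ln1D_ge x : 0 <= x -> x / (1 + x) <= ln (1 + x).
Proof.
move=> x0; have x1 : 0 < 1 + x by lra.
have : ln (1 + (- (x / (1 + x)))) <= - (x / (1 + x)).
  apply: le_ln1Dx; rewrite ltrN2 ltr_pdivrMr //; lra.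
have -> : 1 + - (x / (1 + x)) = (1 + x)^-1 by field; lra.
by rewrite lnV ?posrE // lerN2.
Qed.

Lemma bernoulli x n : 0 <= x -> 1 + n%:R * x <= (1 + x) ^+ n.
Proof.
move=> x0; elim: n => [|n IH]; first by rewrite expr0 mul0r addr0.
rewrite exprS; have : (1 + x) * (1 + n%:R * x) <= (1 + x) * (1 + x) ^+ n.
  by rewrite ler_wpM2l //; lra.
apply: le_trans; rewrite -natr1.
have : 0 <= n%:R * x * x by rewrite !mulr_ge0.
lra.
Qed.

(** Bernoulli's inequality in logarithmic form: constant factors inside [ln (1 + _)] can be moved
    outside. *)
Lemma ln1D_mulr_nat_le x n : 0 <= x -> ln (1 + n%:R * x) <= n%:R * ln (1 + x).
Proof.
move=> x0; have x1 : 0 < 1 + x by lra.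
rewrite (mulr_natl (ln _)) -lnXn // ler_ln ?posrE ?exprn_gt0 ?bernoulli //.
by rewrite ltr_wpDr // mulr_ge0.
Qed.

Definition cgf p b : R := ln (1 - p + p * expR b).
Definition ccgf p b : R := cgf p b - p * b.
Definition cgap p b : R := cgf p b / 2 - cgf p (b / 2).
(** The squared coefficient of variation of [expR (b * F / 2)] for [F] Bernoulli of parameter [p];
    the gap is half the logarithm of one plus it. *)
Definition gapvar p b : R :=
  p * (1 - p) * (expR (b / 2) - 1) ^+ 2 / (1 - p + p * expR (b / 2)) ^+ 2.

Lemma mgf_gt0 p b : 0 < p < 1 -> 0 < 1 - p + p * expR b.
Proof.
move=> hp; have := expR_gt0 b => e0.
have : 0 < p * expR b by (rewrite mulr_gt0 //; lra).
lra.
Qed.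

Lemma expR_half b : expR b = expR (b / 2) ^+ 2.
Proof. by rewrite expr2 -expRD; congr expR; field. Qed.

Lemma expR1_le4 : expR 1 <= 4 :> R.
Proof.
have := expR_ge1Dx (- (1 / 2) : R).
rewrite (expR_half 1) expRN; set e := expR _ => h.
have e0 : 0 < e by apply: expR_gt0.
have : e * (1 / 2) <= e * e^-1 by rewrite ler_pM2l //; lra.
rewrite divff; last by rewrite gt_eqF.
nra.
Qed.

Lemma expR_cgf p b : 0 < p < 1 -> expR (cgf p b) = 1 - p + p * expR b.
Proof. by move=> hp; rewrite lnK // posrE mgf_gt0. Qed.

Lemma gapvar_ge0 p b : 0 < p < 1 -> 0 <= gapvar p b.
Proof.
move=> hp; rewrite /gapvar divr_ge0 ?sqr_ge0 // mulr_ge0 ?sqr_ge0 //.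
by rewrite mulr_ge0 //; lra.
Qed.

Lemma cgapE p b : 0 < p < 1 -> cgap p b = ln (1 + gapvar p b) / 2.
Proof.
move=> hp; have m1 := mgf_gt0 b hp; have m2 := mgf_gt0 (b / 2) hp.
have -> : 1 + gapvar p b =
    (1 - p + p * expR b) / (1 - p + p * expR (b / 2)) ^+ 2.
  rewrite /gapvar (expR_half b); field; lra.
by rewrite ln_div ?posrE ?exprn_gt0 // lnXn // /cgap /cgf -mulr_natl; field.
Qed.

Lemma cgap_ge0 p b : 0 < p < 1 -> 0 <= cgap p b.
Proof.
move=> hp; rewrite cgapE // divr_ge0 // ln_ge0 //.
by have := gapvar_ge0 b hp; lra.
Qed.

Lemma cgf_ge_lnC p b : 0 < p < 1 -> ln (1 - p) <= cgf p b.
Proof.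
move=> hp; rewrite /cgf ler_ln ?posrE ?mgf_gt0 //; last lra.
by rewrite lerDl mulr_ge0 ?expR_ge0 //; lra.
Qed.

Lemma cgf_ge_ln p b : 0 < p < 1 -> b + ln p <= cgf p b.
Proof.
move=> hp; rewrite -{1}(expRK b) -lnM ?posrE ?expR_gt0 //; last lra.
rewrite /cgf ler_ln ?posrE ?mgf_gt0 ?mulr_gt0 ?expR_gt0 //; last lra.
by rewrite mulrC; lra.
Qed.

Lemma cgf_le p b : 0 < p < 1 -> cgf p b <= p * (expR b - 1).
Proof.
move=> hp; have -> : cgf p b = ln (1 + p * (expR b - 1)) by rewrite /cgf; congr ln; ring.
by apply: le_ln1Dx; have := mgf_gt0 b hp; lra.
Qed.

Lemma cgf_ge0 p b : 0 < p < 1 -> 0 <= b -> 0 <= cgf p b.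
Proof.
move=> hp b0; rewrite /cgf ln_ge0 //.
have : p * 1 <= p * expR b by rewrite ler_pM2l ?leNgt ?expR_lt1 -?leNgt //; lra.
lra.
Qed.

Lemma cgf_le_id p b : 0 < p < 1 -> 0 <= b -> cgf p b <= b.
Proof.
move=> hp b0; rewrite /cgf -[leRHS]expRK ler_ln ?posrE ?mgf_gt0 ?expR_gt0 //.
have : (1 - p) * 1 <= (1 - p) * expR b.
  by rewrite ler_pM2l ?leNgt ?expR_lt1 -?leNgt //; lra.
lra.
Qed.

Lemma cgf_le0 p b : 0 < p < 1 -> b <= 0 -> cgf p b <= 0.
Proof.
move=> hp b0; apply: le_trans (cgf_le _ hp) _.
by rewrite pmulr_rle0 ?subr_le0 ?expR_le1 //; lra.
Qed.

Lemma cgf_ge_id p b : 0 < p < 1 -> b <= 0 -> b <= cgf p b.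
Proof.
move=> hp b0; rewrite /cgf -[leLHS]expRK ler_ln ?posrE ?mgf_gt0 ?expR_gt0 //.
have : (1 - p) * expR b <= (1 - p) * 1.
  by rewrite ler_pM2l ?expR_le1 //; lra.
lra.
Qed.

Lemma lnC_ge p : 0 < p <= 1 / 2 -> - ln (1 - p) <= 2 * p.
Proof.
move=> hp; have h : 0 < 1 - p by lra.
rewrite -lnV ?posrE //.
have -> : (1 - p)^-1 = 1 + p / (1 - p) by field; lra.
apply: le_trans (le_ln1Dx _) _.
  by apply: lt_le_trans (_ : 0 <= _); [lra | rewrite divr_ge0; lra].
rewrite ler_pdivrMr //; nra.
Qed.

(** Convexity together with [cgf p 0 = 0]. *)
Lemma cgf_star p b s : 0 < p < 1 -> 0 <= s <= 1 -> cgf p (s * b) <= s * cgf p b.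
Proof.
move=> hp hs.
have key c : expR (s * c) <= 1 + s * (expR c - 1).
  case/andP: hs => s0 s1; have := @convex_expR R (Itv01 s0 s1) c 0.
  by rewrite !convRE /= expR0 mulr0 addr0 mulr1 /unstable.onem; lra.
have h1 := mgf_gt0 b hp; have h2 := mgf_gt0 (s * b) hp.
rewrite /cgf -[leRHS]expRK ler_ln ?posrE ?expR_gt0 //.
set L := ln _; have eL : expR L = 1 - p + p * expR b by rewrite /L lnK ?posrE.
(* After normalisation by [L] the exponentials at [- L] and [b - L] have mean 1, so the two chord
   bounds average to exactly 1 and only the factor [expR (s * L)] remains. *)
have k1 := key (- L); have k2 := key (b - L).
have : expR (s * L) * ((1 - p) * expR (s * - L) + p * expR (s * (b - L)))
   <= expR (s * L) * ((1 - p) * (1 + s * (expR (- L) - 1)) + p * (1 + s * (expR (b - L) - 1))).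
  rewrite ler_pM2l ?expR_gt0 // lerD // ler_pM2l //; lra.
have -> : expR (s * L) * ((1 - p) * expR (s * - L) + p * expR (s * (b - L))) =
   1 - p + p * expR (s * b).
  rewrite mulrBr expRD !mulrN !expRN; field.
  by rewrite gt_eqF // expR_gt0.
move=> /le_trans; apply; rewrite -[leRHS]mulr1 ler_pM2l ?expR_gt0 //.
rewrite expRD expRN eL.
suff -> : (1 - p) * (1 + s * ((1 - p + p * expR b)^-1 - 1)) +
   p * (1 + s * (expR b / (1 - p + p * expR b) - 1)) = 1 by [].
field; lra.
Qed.

Lemma ccgf_star p b s : 0 < p < 1 -> 0 <= s <= 1 -> ccgf p (s * b) <= s * ccgf p b.
Proof. by move=> hp hs; rewrite /ccgf; have := cgf_star b hp hs; lra. Qed.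

(** Cauchy-Schwarz for [expR (b * F / 2)] and [expR (c * F / 2)]; the defect is
    [p * (1 - p) * (u - v) ^+ 2]. *)
Lemma cgf_mid p b c : 0 < p < 1 -> cgf p ((b + c) / 2) <= cgf p b / 2 + cgf p c / 2.
Proof.
move=> hp; have h1 := mgf_gt0 b hp; have h2 := mgf_gt0 c hp.
have h3 := mgf_gt0 ((b + c) / 2) hp.
suff : cgf p ((b + c) / 2) *+ 2 <= cgf p b + cgf p c by rewrite mulr2n; lra.
rewrite /cgf -lnXn // -lnM ?posrE // ler_ln ?posrE ?exprn_gt0 ?mulr_gt0 //.
rewrite (expR_half b) (expR_half c) mulrDl expRD.
set u := expR (b / 2); set v := expR (c / 2).
rewrite -subr_ge0.
have -> : (1 - p + p * u ^+ 2) * (1 - p + p * v ^+ 2) - (1 - p + p * (u * v)) ^+ 2 =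
  (p * (1 - p)) * (u - v) ^+ 2 by ring.
by rewrite mulr_ge0 ?sqr_ge0 // mulr_ge0; lra.
Qed.

Lemma ccgf_mid p b c : 0 < p < 1 -> ccgf p ((b + c) / 2) <= ccgf p b / 2 + ccgf p c / 2.
Proof. by move=> hp; rewrite /ccgf; have := cgf_mid b c hp; lra. Qed.

Lemma ln1D_half_ge x : 0 <= x <= 1 -> x / 2 <= ln (1 + x).
Proof.
move=> hx; apply: le_trans (ln1D_ge _); last lra.
by rewrite ler_wpM2l ?lef_pV2 ?posrE; lra.
Qed.

Lemma expRN_half_ge x : 0 <= x <= 1 -> x / 2 <= 1 - expR (- x).
Proof.
move=> hx; have x1 : 0 < 1 + x by lra.
have : expR (- x) <= (1 + x)^-1 by rewrite expRN lef_pV2 ?posrE ?expR_gt0 // expR_ge1Dx.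
have : x / 2 <= x / (1 + x) by rewrite ler_wpM2l ?lef_pV2 ?posrE; lra.
have -> : x / (1 + x) = 1 - (1 + x)^-1 by field; lra.
lra.
Qed.

(** * Lower bounds on the Jensen gap in each regime of [b] *)

Lemma gapvar_neg_ge p b : 0 < p <= 1 / 2 -> b <= 0 ->
  p / 2 * (1 - expR (b / 2)) ^+ 2 <= gapvar p b.
Proof.
move=> hp b0; rewrite /gapvar; set t := expR (b / 2).
have t0 : 0 < t := expR_gt0 _.
have t1 : t <= 1 by rewrite expR_le1; lra.
have d0 : 0 < 1 - p + p * t by nra.
have d1 : 1 - p + p * t <= 1 by nra.
rewrite ler_pdivlMr ?exprn_gt0 //.
have -> : (1 - t) ^+ 2 = (t - 1) ^+ 2 by ring.
have h1 : p / 2 * (t - 1) ^+ 2 <= p * (1 - p) * (t - 1) ^+ 2.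
  by rewrite ler_wpM2r ?sqr_ge0 //; nra.
apply: le_trans h1; rewrite -[leRHS]mulr1 ler_wpM2l //.
  by rewrite mulr_ge0 ?sqr_ge0 //; lra.
by rewrite expr_le1 // ltW.
Qed.

Lemma gapvar_neg_le1 p b : 0 < p <= 1 / 2 -> b <= 0 -> gapvar p b <= 1.
Proof.
move=> hp b0; rewrite /gapvar; set t := expR (b / 2).
have t0 : 0 < t := expR_gt0 _.
have t1 : t <= 1 by rewrite expR_le1; lra.
have d0 : 0 < 1 - p + p * t by nra.
rewrite ler_pdivrMr ?exprn_gt0 // mul1r.
have h : p * (1 - p) * (t - 1) ^+ 2 <= 1 / 4 * 1.
  apply: ler_pM; rewrite ?sqr_ge0 //; nra.
by apply: le_trans h _; rewrite expr2; nra.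
Qed.

Lemma cgap_neg_small p b : 0 < p <= 1 / 2 -> - 2 <= b <= 0 ->
  p * b ^+ 2 / 128 <= cgap p b.
Proof.
move=> hp hb; rewrite cgapE; last lra.
have X0 := gapvar_ge0 b (_ : 0 < p < 1); have {}X0 := X0 ltac:(lra).
have X1 := gapvar_neg_le1 hp (_ : b <= 0); have {}X1 := X1 ltac:(lra).
have := ln1D_half_ge (_ : 0 <= gapvar p b <= 1) => /(_ ltac:(lra)) hl.
have := gapvar_neg_ge hp (_ : b <= 0) => /(_ ltac:(lra)) hX.
have := @expRN_half_ge (- b / 2) => /(_ ltac:(lra)).
rewrite mulNr opprK => he.
have : (- b / 4) ^+ 2 <= (1 - expR (b / 2)) ^+ 2.
  by rewrite ler_sqr ?nnegrE; lra.
have -> : (- b / 4) ^+ 2 = b ^+ 2 / 16 by field.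
move=> h2; have := ler_wpM2l (_ : 0 <= p / 2) h2 => /(_ ltac:(lra)).
lra.
Qed.

Lemma cgap_neg_big p b : 0 < p <= 1 / 2 -> b <= - 2 -> p / 32 <= cgap p b.
Proof.
move=> hp hb; rewrite cgapE; last lra.
have X0 := gapvar_ge0 b (_ : 0 < p < 1); have {}X0 := X0 ltac:(lra).
have X1 := gapvar_neg_le1 hp (_ : b <= 0); have {}X1 := X1 ltac:(lra).
have := ln1D_half_ge (_ : 0 <= gapvar p b <= 1) => /(_ ltac:(lra)) hl.
have := gapvar_neg_ge hp (_ : b <= 0) => /(_ ltac:(lra)) hX.
have := @expRN_half_ge 1 => /(_ ltac:(lra)) he.
have : expR (b / 2) <= expR (- 1) by rewrite ler_expR; lra.
move=> he2.
have : (1 / 2) ^+ 2 <= (1 - expR (b / 2)) ^+ 2 by rewrite ler_sqr ?nnegrE; lra.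
have -> : (1 / 2) ^+ 2 = 1 / 4 :> R by field.
move=> h2; have := ler_wpM2l (_ : 0 <= p / 2) h2 => /(_ ltac:(lra)).
lra.
Qed.

Lemma gapvar_pos_small p b : 0 < p <= 1 / 2 -> 0 <= b -> p * expR (b / 2) <= 1 ->
  p / 8 * (expR (b / 2) - 1) ^+ 2 <= gapvar p b.
Proof.
move=> hp b0; rewrite /gapvar; set t := expR (b / 2) => pt.
have t0 : 0 < t := expR_gt0 _.
have d0 : 0 < 1 - p + p * t by nra.
have d1 : (1 - p + p * t) ^+ 2 <= 2 ^+ 2 by rewrite ler_sqr ?nnegrE; lra.
rewrite ler_pdivlMr ?exprn_gt0 //.
apply: (@le_trans _ _ (p / 8 * (t - 1) ^+ 2 * 2 ^+ 2)).
  by rewrite ler_wpM2l // mulr_ge0 ?sqr_ge0 //; lra.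
have -> : p / 8 * (t - 1) ^+ 2 * 2 ^+ 2 = p * (1 / 2) * (t - 1) ^+ 2 by field.
by rewrite ler_wpM2r ?sqr_ge0 //; nra.
Qed.

Lemma gapvar_pos_big p b : 0 < p <= 1 / 2 -> 0 <= b -> 1 <= p * expR (b / 2) ->
  (32 * p)^-1 <= gapvar p b.
Proof.
move=> hp b0; rewrite /gapvar; set t := expR (b / 2) => pt.
have t2 : 2 <= t by nra.
have d0 : 0 < 1 - p + p * t by nra.
have d1 : (1 - p + p * t) ^+ 2 <= (2 * (p * t)) ^+ 2 by rewrite ler_sqr ?nnegrE; nra.
rewrite ler_pdivlMr ?exprn_gt0 //.
apply: (@le_trans _ _ ((32 * p)^-1 * (2 * (p * t)) ^+ 2)).
  by rewrite ler_wpM2l // invr_ge0; lra.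
have -> : (32 * p)^-1 * (2 * (p * t)) ^+ 2 = p * (1 / 2) * (t / 2) ^+ 2 by field; lra.
by apply: ler_pM; rewrite ?sqr_ge0 //; nra.
Qed.

(** Past this threshold [gapvar] is at least [1 / (32 * p)], so the gap pays for the whole surprise
    [- ln p] of a flip. The factor 32 leaves the logarithm through [ln1D_mulr_nat_le]. *)
Lemma cgap_sat_pos p b : 0 < p <= 1 / 2 -> 0 <= b -> 1 <= p * expR (b / 2) ->
  - ln p <= 64 * cgap p b.
Proof.
move=> hp b0 pt; rewrite cgapE; last lra.
have hX := gapvar_pos_big hp b0 pt.
have p1 : 0 < p^-1 by rewrite invr_gt0; lra.
have : ln (1 + 32%:R * ((32 * p)^-1)) <= 32%:R * ln (1 + (32 * p)^-1).
  by apply: ln1D_mulr_nat_le; rewrite invr_ge0; lra.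
have -> : 32%:R * (32 * p)^-1 = p^-1 by field; lra.
have : ln (1 + (32 * p)^-1) <= ln (1 + gapvar p b).
  have h0 : 0 < (32 * p)^-1 by rewrite invr_gt0; lra.
  by rewrite ler_ln ?posrE; lra.
have : - ln p <= ln (1 + p^-1) by rewrite -lnV ?posrE ?ler_ln ?posrE; lra.
lra.
Qed.

Lemma cgap_sat_neg p b : 0 < p <= 1 / 2 -> b <= - 2 -> - ln (1 - p) <= 64 * cgap p b.
Proof. by move=> hp hb; have := lnC_ge hp; have := cgap_neg_big hp hb; lra. Qed.

(** Summed over indices, this shows that much mass with projections above [x] forces a large total
    gap. *)
Lemma cgap_mass p b x : 0 < p <= 1 / 2 -> 2 <= x -> x <= b -> p * expR x <= 1 ->
  p * expR x / 128 <= cgap p b.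
Proof.
move=> hp x2 xb px; rewrite cgapE; last lra.
have ex0 := expR_gt0 x.
suff hX : p * expR x / 32 <= gapvar p b.
  have := @ln1D_half_ge (p * expR x / 32) => /(_ ltac:(nra)) hl.
  have : ln (1 + p * expR x / 32) <= ln (1 + gapvar p b).
    by rewrite ler_ln ?posrE; nra.
  lra.
have [pt|pt] := leP (p * expR (b / 2)) 1.
  apply: le_trans (gapvar_pos_small hp _ pt); last lra.
  have e1 : 2 <= expR (b / 2).
    by apply: le_trans (expR_ge1Dx _); lra.
  have e2 : expR (x / 2) <= expR (b / 2) by rewrite ler_expR; lra.
  have e3 := expR_gt0 (x / 2).
  rewrite (expR_half x).
  have : (expR (x / 2) / 2) ^+ 2 <= (expR (b / 2) - 1) ^+ 2.
    by rewrite ler_sqr ?nnegrE; lra.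
  move=> h; have := ler_wpM2l (_ : 0 <= p / 8) h => /(_ ltac:(lra)).
  by apply: le_trans; rewrite le_eqVlt; apply/orP; left; apply/eqP; field.
apply: le_trans (gapvar_pos_big hp _ (ltW pt)); last lra.
rewrite invfM mulrC ler_pM2l; last by rewrite invr_gt0; lra.
have -> : p^-1 = 1 / p by rewrite div1r.
rewrite ler_pdivlMr; nra.
Qed.

(** * Upper bounds on the centered cumulant *)

Lemma ccgf_neg_le p a : 0 < p < 1 -> 0 <= a -> ccgf p (- a) <= p * a.
Proof.
move=> hp a0; have := @cgf_le0 p (- a) hp; rewrite /ccgf; lra.
Qed.

Lemma ccgf_neg_le_sqr p a : 0 < p < 1 -> 0 <= a -> ccgf p (- a) <= p * a ^+ 2.
Proof.
move=> hp a0; have := cgf_le (- a) hp; rewrite /ccgf.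
have a1 : 0 < 1 + a by lra.
have : expR (- a) <= (1 + a)^-1 by rewrite expRN lef_pV2 ?posrE ?expR_gt0 // expR_ge1Dx.
have : (1 + a)^-1 <= 1 - a + a ^+ 2.
  have -> : (1 + a)^-1 = 1 / (1 + a) by rewrite div1r.
  rewrite ler_pdivrMr //.
  have : 0 <= a ^+ 3 by rewrite exprn_ge0.
  lra.
nra.
Qed.

Lemma ccgf_pos_le_sqr p s : 0 < p < 1 -> 0 <= s <= 1 / 2 -> ccgf p s <= 2 * p * s ^+ 2.
Proof.
move=> hp hs; have := cgf_le s hp; rewrite /ccgf.
have a1 : 0 < 1 - s by lra.
have : expR s <= (1 - s)^-1.
  rewrite -[s in leLHS]opprK expRN lef_pV2 ?posrE ?expR_gt0 //.
  exact: expR_ge1Dx.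
have : (1 - s)^-1 <= 1 + s + 2 * s ^+ 2.
  have -> : (1 - s)^-1 = 1 / (1 - s) by rewrite div1r.
  rewrite ler_pdivrMr //.
  have : 0 <= s ^+ 2 * (1 - 2 * s) by rewrite mulr_ge0 ?sqr_ge0 //; lra.
  lra.
nra.
Qed.

(* Between the two saturation thresholds the cumulant is controlled by its
   Jensen gap, with a loss linear in the size [A] of the window. *)
Lemma ccgf_le_cgap p b A : 0 < p <= 1 / 2 -> 1 <= A -> - A <= b ->
  b <= A * (2 * - ln p) -> ccgf p b <= 128 * A * cgap p b.
Proof.
move=> hp A1 Ab bA.
have hp' : 0 < p < 1 by lra.
have g0 := cgap_ge0 b hp'.
have gA : cgap p b <= A * cgap p b by nra.
have [b0|b0] := leP b 0.
  have [b2|b2] := leP (- 2) b.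
    have := cgap_neg_small hp (_ : -2 <= b <= 0) => /(_ ltac:(lra)).
    have := @ccgf_neg_le_sqr p (- b) hp'; rewrite opprK sqrrN => /(_ ltac:(lra)).
    nra.
  have := cgap_neg_big hp (ltW b2).
  have := @ccgf_neg_le p (- b) hp'; rewrite opprK => /(_ ltac:(lra)).
  nra.
have phi_psi : ccgf p b <= cgf p b by rewrite /ccgf; nra.
(* Upward saturated case: [b] is at most [A] times [2 * - ln p], and the gap pays for [- ln p]. *)
have [pt|pt] := leP 1 (p * expR (b / 2)).
  have h1 := cgap_sat_pos hp (ltW b0) pt.
  have h2 := cgf_le_id hp' (ltW b0).
  have : A * (2 * - ln p) <= A * (2 * (64 * cgap p b)) by rewrite ler_pM2l ?ler_pM2l; lra.
  lra.
have hX := gapvar_pos_small hp (ltW b0) (ltW pt).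
have X0 := gapvar_ge0 b hp'.
have gE := cgapE b hp'.
have t0 := expR_gt0 (b / 2).
suff : ccgf p b <= 64 * ln (1 + gapvar p b) by lra.
(* With [t = expR (b / 2)]: for [t <= 2] both sides are quadratic in [t - 1]; for [t > 2] the factor
   [t ^+ 2] is at most [4 * (t - 1) ^+ 2], so the logarithms compare directly. *)
have [t2|t2] := leP (expR (b / 2)) 2.
  have t1 : 1 <= expR (b / 2) by rewrite leNgt expR_lt1 -leNgt; lra.
  have X1 : gapvar p b <= 1.
    rewrite /gapvar ler_pdivrMr ?mul1r; last by rewrite exprn_gt0 // mgf_gt0.
    have h : p * (1 - p) * (expR (b / 2) - 1) ^+ 2 <= 1 / 4 * 1.
      by apply: ler_pM; rewrite ?sqr_ge0 //; nra.
    apply: le_trans h _; rewrite -[leLHS]mulr1 expr2.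
    by apply: ler_pM; nra.
  have := @ln1D_half_ge (gapvar p b) => /(_ ltac:(lra)).
  have := cgf_le b hp'.
  have tt : expR (- (b / 2)) = (expR (b / 2))^-1 by rewrite expRN.
  have := expR_ge1Dx (- (b / 2)); rewrite tt => ti.
  have tinv : (expR (b / 2))^-1 <= 1 - (expR (b / 2) - 1) + (expR (b / 2) - 1) ^+ 2.
    have -> : (expR (b / 2))^-1 = 1 / expR (b / 2) by rewrite div1r.
    rewrite ler_pdivrMr //.
    have : 0 <= (expR (b / 2) - 1) ^+ 3 by rewrite exprn_ge0 //; lra.
    lra.
  rewrite /ccgf (expR_half b) => h1 h2.
  have : p * (expR (b / 2) ^+ 2 - 1) - p * b <= 3 * (p * (expR (b / 2) - 1) ^+ 2) by nra.
  lra.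
apply: (le_trans phi_psi).
have h32 : ln (1 + 32%:R * gapvar p b) <= 32%:R * ln (1 + gapvar p b) by apply: ln1D_mulr_nat_le.
have l0 : 0 <= ln (1 + gapvar p b) by rewrite ln_ge0; lra.
suff : cgf p b <= ln (1 + 32%:R * gapvar p b) by lra.
rewrite /cgf ler_ln ?posrE ?mgf_gt0 //; last lra.
rewrite (expR_half b).
have : (expR (b / 2) / 2) ^+ 2 <= (expR (b / 2) - 1) ^+ 2.
  by rewrite ler_sqr ?nnegrE; lra.
have -> : (expR (b / 2) / 2) ^+ 2 = expR (b / 2) ^+ 2 / 4 by field.
nra.
Qed.

(** The reflected cumulant is at most both [p * s] and [p * s ^+ 2], while the gap at [b] is at
    least a constant times the minimum of [p * b ^+ 2] and 1. This bounds the cumulant on the side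
    of the origin opposite to [b]. *)
Lemma ccgf_reflect_pos p b s : 0 < p <= 1 / 2 -> 0 <= s <= b -> p * s <= 1 ->
  ccgf p (- s) <= 128 * cgap p b.
Proof.
move=> hp hs ps1; have hp' : 0 < p < 1 by lra.
have b0 : 0 <= b by lra.
have h1 := @ccgf_neg_le p s hp' ltac:(lra).
have h2 := @ccgf_neg_le_sqr p s hp' ltac:(lra).
have X0 := gapvar_ge0 b hp'.
have hlow y : 0 <= y <= 1 -> y <= gapvar p b -> y / 2 <= ln (1 + gapvar p b).
  move=> hy yX; apply: le_trans (ln1D_half_ge hy) _.
  by rewrite ler_ln ?posrE; lra.
rewrite cgapE //.
have s2 : p * s ^+ 2 <= p * b ^+ 2.
  by rewrite ler_wpM2l ?ler_sqr ?nnegrE; lra.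
have [pt|pt] := leP (p * expR (b / 2)) 1.
  have := gapvar_pos_small hp b0 pt.
  have : (b / 2) ^+ 2 <= (expR (b / 2) - 1) ^+ 2.
    by rewrite ler_sqr ?nnegrE; have := expR_ge1Dx (b / 2); lra.
  have -> : (b / 2) ^+ 2 = b ^+ 2 / 4 by field.
  move=> h3 h4.
  have h5 : p * b ^+ 2 / 32 <= gapvar p b by nra.
  have [y1|y1] := leP (p * b ^+ 2 / 32) 1.
    have := hlow (p * b ^+ 2 / 32) ltac:(nra) h5; lra.
  have := hlow 1 ltac:(lra) ltac:(lra); lra.
have := gapvar_pos_big hp b0 (ltW pt).
have : (1 / 16 : R) <= (32 * p)^-1.
  have -> : (1 / 16 : R) = 16^-1 by rewrite div1r.
  by rewrite lef_pV2 ?posrE; lra.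
move=> h3 h4; have := hlow (1 / 16) ltac:(lra) ltac:(lra); lra.
Qed.

(** Here the cumulant at [s] is at most [2 * p * s ^+ 2], and the gap at [b] is of order at least
    [p] times the minimum of [b ^+ 2] and 1. *)
Lemma ccgf_reflect_neg p b s : 0 < p <= 1 / 2 -> b <= 0 -> 0 <= s <= 1 / 2 ->
  s <= - b / 4 -> ccgf p s <= 128 * cgap p b.
Proof.
move=> hp b0 hs sb; have hp' : 0 < p < 1 by lra.
have := ccgf_pos_le_sqr hp' hs.
have [b2|b2] := leP (- 2) b.
  have := cgap_neg_small hp (_ : - 2 <= b <= 0) => /(_ ltac:(lra)).
  have : s ^+ 2 <= (- b / 4) ^+ 2 by rewrite ler_sqr ?nnegrE; lra.
  have -> : (- b / 4) ^+ 2 = b ^+ 2 / 16 by field.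
  nra.
have := cgap_neg_big hp (ltW b2).
have : s ^+ 2 <= 1 by nra.
nra.
Qed.

End Cumulant.

(** * Spanning pairs and half-plane patterns in the plane *)

Lemma set_argmax (R : realType) (T : finType) (A : {set T}) (f : T -> R) :
  A != set0 -> exists2 a, a \in A & forall i, i \in A -> f i <= f a.
Proof.
case/set0Pn => i0 i0A; case: (@Order.TotalTheory.arg_maxP _ _ _ i0 (mem A) f i0A) => a aA ha.
by exists a => // i iA; apply: ha.
Qed.

Lemma set_argmin (R : realType) (T : finType) (A : {set T}) (f : T -> R) :
  A != set0 -> exists2 a, a \in A & forall i, i \in A -> f a <= f i.
Proof.
move=> /(@set_argmax _ _ _ (fun i => - f i)) [a aA ha]; exists a => // i iA.
by rewrite -lerN2 ha.
Qed.

(* A pair of maximal determinant spans all the others with coefficients in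
   [-1, 1]; when all determinants vanish, the longest vector does. *)
Lemma spanning_pair (R : realType) (T : finType) (A : {set T}) (x y : T -> R) :
  A != set0 ->
  exists a b, [/\ a \in A, b \in A & forall i, i \in A ->
    exists al be, [/\ `|al| <= 1, `|be| <= 1,
      x i = al * x a + be * x b & y i = al * y a + be * y b]].
Proof.
case/set0Pn => i0 i0A.
pose D (u : T * T) := x u.1 * y u.2 - x u.2 * y u.1.
have i00 : (i0, i0) \in setX A A by rewrite in_setX i0A.
have /(set_argmax (fun u => `|D u|))[[a b]] : setX A A != set0 by apply/set0Pn; exists (i0, i0).
rewrite in_setX /= => /andP[aA bA] hmax.
have [D0|D0] := eqVneq (D (a, b)) 0; last first.
  exists a, b; split=> // i iA.
  (* Cramer's rule; both numerators are bounded by the maximal determinant. *)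
  exists (D (i, b) / D (a, b)), (D (a, i) / D (a, b)).
  rewrite !normrM !normfV !ler_pdivrMr ?normr_gt0 // !mul1r.
  rewrite (hmax (i, b)) ?(hmax (a, i)) ?in_setX /= ?iA ?aA ?bA //.
  move: D0; rewrite /D /= => D0; split => //; field; exact: D0.
have {hmax} hz i j : i \in A -> j \in A -> x i * y j = x j * y i.
  move=> iA jA; have := hmax (i, j); rewrite in_setX /= iA jA => /(_ isT).
  by rewrite D0 normr0 normr_le0 subr_eq0 => /eqP.
have /(set_argmax (fun u => x u ^+ 2 + y u ^+ 2))[c cA hc] : A != set0 by apply/set0Pn; exists i0.
exists c, c; split=> // i iA; have {}hc := hc i iA.
have s0 : 0 <= x c ^+ 2 + y c ^+ 2 by rewrite addr_ge0 ?sqr_ge0.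
have [n0|n0] := eqVneq (x c ^+ 2 + y c ^+ 2) 0.
  exists 0, 0; rewrite normr0 ler01 !mul0r !addr0.
  have : x i ^+ 2 + y i ^+ 2 == 0 by rewrite eq_le -{1}n0 hc addr_ge0 ?sqr_ge0.
  by rewrite paddr_eq0 ?sqr_ge0 // !sqrf_eq0 => /andP[/eqP -> /eqP ->].
have nc : 0 < x c ^+ 2 + y c ^+ 2 by rewrite lt_def n0.
(* All vectors are collinear, so each one equals its orthogonal projection on the longest. *)
exists ((x i * x c + y i * y c) / (x c ^+ 2 + y c ^+ 2)), 0.
have e := hz _ _ iA cA.
have ex : x i = (x i * x c + y i * y c) / (x c ^+ 2 + y c ^+ 2) * x c.
  rewrite mulrAC; apply: (canRL (mulfK n0)).
  transitivity (x i * x c ^+ 2 + (x i * y c) * y c); first ring.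
  rewrite e; ring.
have ey : y i = (x i * x c + y i * y c) / (x c ^+ 2 + y c ^+ 2) * y c.
  rewrite mulrAC; apply: (canRL (mulfK n0)).
  transitivity (y i * y c ^+ 2 + (x c * y i) * x c); first ring.
  rewrite -e; ring.
split; rewrite ?normr0 ?mul0r ?addr0 //.
set al := _ / _ in ex ey *.
have : al ^+ 2 <= 1 ^+ 2.
  move: hc; rewrite {1}ex {1}ey !exprMn -mulrDr.
  by rewrite -[leRHS]mul1r ler_pM2r // expr1n.
by rewrite -real_normK ?num_real // ler_sqr ?nnegrE.
Qed.

(* Remove a dominating pair [t] times; any surviving [i] with [Q i w] then
   forces [Q'] at a member of each removed pair. *)
Lemma dominating_rounds (T : finType) (W : Type) (Q Q' : T -> W -> Prop) :
  (forall A : {set T}, A != set0 -> exists a b, [/\ a \in A, b \in A &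
    forall i w, i \in A -> Q i w -> Q' a w \/ Q' b w]) ->
  forall (t : nat) (A : {set T}), exists X : {set T},
    [/\ X \subset A, (#|X| <= 2 * t)%N &
      forall w i, i \in A :\: X -> Q i w ->
        (t <= #|[set j in X | `[< Q' j w >]]|)%N].
Proof.
move=> dom; elim=> [|t IH] A.
  by exists set0; rewrite sub0set cards0.
have [->|A0] := eqVneq A set0.
  exists set0; rewrite sub0set cards0; split=> // w i.
  by rewrite setD0 in_set0.
have [a [b [aA bA hab]]] := dom _ A0.
have [X [XA Xt hX]] := IH (A :\: [set a; b]).
exists (X :|: [set a; b]); split.
- rewrite subUset (subset_trans XA) ?subsetDl //=.
  by apply/subsetP => i; rewrite !inE => /orP[] /eqP ->.
- apply: leq_trans (leq_card_setU _ _) _; rewrite cards2; lia.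
move=> w i; rewrite !inE negb_or => /andP[/andP[iX iab] iA] Qi.
have h1 : (t <= #|[set j in X | `[< Q' j w >]]|)%N.
  by apply: hX (Qi); rewrite !inE iX iab.
have [c [cab cX Qc]] : exists c, [/\ c \in [set a; b], c \notin X & Q' c w].
  have hn c : c \in [set a; b] -> c \notin X.
    by move=> cc; apply/negP => /(subsetP XA); rewrite inE cc.
  by case: (hab i w iA Qi) => ?; [exists a | exists b]; split => //;
     rewrite ?hn // !inE eqxx ?orbT.
apply: leq_ltn_trans h1 _; apply: proper_card; apply/properP; split.
  by apply/subsetP => j; rewrite !inE => /andP[-> ->].
exists c; last by rewrite inE (negbTE cX).
by move: cab; rewrite !inE => ->; rewrite orbT /=; apply/asboolP.
Qed.

(** * Counting the sign patterns of finitely many lines *)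

Section HalfPlanePatterns.
Variables (R : realType) (T : finType) (c0 c1 c2 : T -> R).
Implicit Types (E : R * R -> Prop) (D : {set T}) (l : T) (w u v : R * R).

Definition affine l w := c1 l * w.1 + c2 l * w.2 - c0 l.
Definition pattern D w := [set l in D | 0 < affine l w].
Definition patterns E D : {set {set T}} :=
  [set pi | `[< exists w, E w /\ pi = pattern D w >]].
Definition segment_closed E := forall u v s, 0 <= s <= 1 -> E u -> E v ->
  E (u.1 + s * (v.1 - u.1), u.2 + s * (v.2 - u.2)).

Lemma affine_seg l u v s :
  affine l (u.1 + s * (v.1 - u.1), u.2 + s * (v.2 - u.2)) =
  (1 - s) * affine l u + s * affine l v.
Proof. rewrite /affine /=; ring. Qed.

Lemma segment_closedI E (P : R -> bool) l : segment_closed E ->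
  (forall s a b, 0 <= s <= 1 -> P a -> P b -> P ((1 - s) * a + s * b)) ->
  segment_closed (fun w => E w /\ P (affine l w)).
Proof.
move=> cE cP u v s hs [Eu Pu] [Ev Pv]; split; first exact: cE.
by rewrite affine_seg; apply: cP.
Qed.

Lemma pattern_setU1 D l w : l \notin D ->
  pattern (l |: D) w = if 0 < affine l w then l |: pattern D w else pattern D w.
Proof.
move=> lD; apply/setP => j; rewrite !inE; case: ifP => h; rewrite !inE.
  by case: eqP => [->|]//=; rewrite h.
by case: eqP => [->|]//=; rewrite h (negbTE lD).
Qed.

Lemma patternsS E E' D : (forall w, E w -> E' w) -> patterns E D \subset patterns E' D.
Proof.
move=> EE; apply/subsetP => pi; rewrite !inE => /asboolP[w [Ew ->]].
by apply/asboolP; exists w; split; first exact: EE.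
Qed.

(* Cutting by a line duplicates only the patterns met along that line. *)
Lemma card_patterns_setU1 E D l : segment_closed E -> l \notin D ->
  (#|patterns E (l |: D)| <=
   #|patterns E D| + #|patterns (fun w => E w /\ affine l w == 0%R) D|)%N.
Proof.
move=> cE lD.
pose P1 := patterns (fun w => E w /\ affine l w <= 0) D.
pose P2 := patterns (fun w => E w /\ 0 < affine l w) D.
have : patterns E (l |: D) \subset P1 :|: [set l |: pi | pi in P2].
  apply/subsetP => pi; rewrite inE => /asboolP[w [Ew ->]].
  rewrite pattern_setU1 // inE; case: ifP => h; apply/orP.
    by right; apply: imset_f; rewrite inE; apply/asboolP; exists w.
  by left; rewrite inE; apply/asboolP; exists w; rewrite leNgt h.
move/subset_leq_card => /leq_trans; apply.
apply: leq_trans (leq_card_setU _ _) _.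
apply: leq_trans (leq_add (leqnn _) (leq_imset_card _ _)) _.
rewrite -(cardsUI P1 P2) leq_add //; apply: subset_leq_card.
  rewrite subUset /P1 /P2; apply/andP; split; apply: patternsS => w; tauto.
apply/subsetP => pi; rewrite !inE => /andP[/asboolP[u [[Eu lu] ->]] /asboolP[v [[Ev lv] e]]].
apply/asboolP.
(* A pattern met on both sides of [l] is also met on [l]: [s] is where the segment from [u] to [v]
   crosses it, and the signs of the other lines agree at both ends. *)
pose s := affine l u / (affine l u - affine l v).
have hd : affine l u - affine l v < 0 by lra.
have hs : 0 <= s <= 1.
  rewrite /s; apply/andP; split; first by rewrite ler_ndivlMr // mul0r.
  by rewrite ler_ndivrMr // mul1r; lra.
exists (u.1 + s * (v.1 - u.1), u.2 + s * (v.2 - u.2)); split.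
  split; first exact: cE.
  rewrite affine_seg; apply/eqP; rewrite /s; field; lra.
apply/setP => j; rewrite !inE affine_seg.
case jD : (j \in D) => //=.
move/setP: e => /(_ j); rewrite !inE jD /= => e.
have [ju|ju] := ltP 0 (affine j u).
  have jv : 0 < affine j v by rewrite -e.
  symmetry; have [->|s1] := eqVneq s 1; first by rewrite subrr mul0r add0r mul1r.
  have s1' : s < 1 by case/andP: hs => _; rewrite lt_neqAle s1.
  by apply: ltr_wpDr; [apply: mulr_ge0; lra | apply: mulr_gt0; lra].
have jv : affine j v <= 0 by rewrite leNgt -e -leNgt.
have h1 : 0 <= (1 - s) * - affine j u by (apply: mulr_ge0; lra).
have h2 : 0 <= s * - affine j v by (apply: mulr_ge0; lra).
by apply/esym/negbTE; rewrite -leNgt; lra.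
Qed.

Lemma card_patterns_point E D : (forall u v, E u -> E v -> u = v) ->
  (#|patterns E D| <= 1)%N.
Proof.
move=> sE; apply/card_le1_eqP => p1 p2; rewrite !inE.
by move=> /asboolP[u [Eu ->]] /asboolP[v [Ev ->]]; rewrite (sE _ _ Eu Ev).
Qed.

Lemma patterns_setU1_zero E D l : l \notin D -> (forall w, E w -> affine l w == 0) ->
  patterns E (l |: D) = patterns E D.
Proof.
move=> lD z; apply/setP => pi; rewrite !inE; apply: asbool_equiv_eq.
have h w : E w -> pattern (l |: D) w = pattern D w.
  by move=> Ew; rewrite pattern_setU1 // (eqP (z _ Ew)) ltxx.
by split => -[w [Ew e]]; exists w; split => //; rewrite e h.
Qed.

(** Each line either contains [E] and separates nothing, or meets it in at most one point and adds
    at most one pattern. *)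
Lemma card_patterns_line E D : segment_closed E ->
  (forall l, (forall w, E w -> affine l w == 0) \/
     (forall u v, E u -> E v -> affine l u == 0 -> affine l v == 0 -> u = v)) ->
  (#|patterns E D| <= #|D|.+1)%N.
Proof.
move=> cE lE; elim: {D}#|D| {1 3}D (erefl #|D|) => [|n IH] D.
  move=> /eqP; rewrite cards_eq0 => /eqP ->.
  rewrite -(cards1 (set0 : {set T})); apply: subset_leq_card.
  apply/subsetP => pi; rewrite !inE => /asboolP[w [_ ->]].
  by apply/eqP/setP => j; rewrite !inE.
move=> hD; have /card_gt0P[l lD] : (0 < #|D|)%N by rewrite hD.
have lD' : l \notin D :\ l by rewrite !inE eqxx.
have hD' : #|D :\ l| = n by move: hD; rewrite (cardsD1 l) lD => -[].
rewrite -(setD1K lD); have {}IH := IH _ hD'.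
case: (lE l) => h; first by rewrite patterns_setU1_zero // ltnW.
apply: leq_trans (card_patterns_setU1 cE lD') _; rewrite -addn1 leq_add //.
by apply: card_patterns_point => u v [Eu u0] [Ev v0]; exact: h.
Qed.

(** Induction on [D]: the new line adds at most as many patterns as the others cut out along it,
    which is at most linear. *)
Lemma card_patterns_plane D : (#|patterns (fun=> True) D| <= #|D|.+1 ^ 2)%N.
Proof.
have cT : segment_closed (fun=> True) by [].
elim: {D}#|D| {1 3}D (erefl #|D|) => [|n IH] D.
  move=> /eqP; rewrite cards_eq0 => /eqP ->; rewrite exp1n.
  rewrite -(cards1 (set0 : {set T})); apply: subset_leq_card.
  apply/subsetP => pi; rewrite !inE => /asboolP[w [_ ->]].
  by apply/eqP/setP => j; rewrite !inE.
move=> hD; have /card_gt0P[l lD] : (0 < #|D|)%N by rewrite hD.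
have lD' : l \notin D :\ l by rewrite !inE eqxx.
have hD' : #|D :\ l| = n by move: hD; rewrite (cardsD1 l) lD => -[].
rewrite -(setD1K lD); have {}IH := IH _ hD'.
have [z|nz] := pselect (forall w, affine l w == 0).
  rewrite patterns_setU1_zero //; apply: leq_trans IH _.
  by rewrite leq_exp2r.
apply: leq_trans (card_patterns_setU1 cT lD') _.
suff : (#|patterns (fun w => True /\ affine l w == 0%R) (D :\ l)| <= n.+1)%N by nia.
rewrite -hD'; apply: card_patterns_line.
  apply: (segment_closedI (P := fun a => a == 0)) => // s a b _ /eqP -> /eqP ->.
  by rewrite !mulr0 addr0.
move=> l'; have [h|h] := pselect (forall u v, True /\ affine l u == 0 ->
  True /\ affine l v == 0 -> affine l' u == 0 -> affine l' v == 0 -> u = v).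
  by right.
left => w [_ lw].
(* Two distinct common points of [l] and [l'] force [l'] to contain [l]; the cross product [cr]
   below expresses that [w], [u] and [v] are collinear. *)
have [u [v [/eqP lu /eqP lv /eqP l'u /eqP l'v uv]]] : exists u v,
    [/\ affine l u == 0, affine l v == 0, affine l' u == 0, affine l' v == 0 & u <> v].
  apply: contrapT => hn; apply: h => u v [_ lu] [_ lv] l'u l'v.
  by apply: contrapT => uv; apply: hn; exists u, v.
move/eqP: lw => lw; apply/eqP.
have e1 : c1 l * (w.1 - u.1) + c2 l * (w.2 - u.2) = 0 by move: lw lu; rewrite /affine; lra.
have e2 : c1 l * (v.1 - u.1) + c2 l * (v.2 - u.2) = 0 by move: lv lu; rewrite /affine; lra.
have e3 : c1 l' * (v.1 - u.1) + c2 l' * (v.2 - u.2) = 0 by move: l'v l'u; rewrite /affine; lra.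
have cr : (w.1 - u.1) * (v.2 - u.2) = (w.2 - u.2) * (v.1 - u.1).
  have [c10|c10] := eqVneq (c1 l) 0; last first.
    apply: (mulfI c10).
    have -> : c1 l * ((w.1 - u.1) * (v.2 - u.2)) = (c1 l * (w.1 - u.1)) * (v.2 - u.2) by ring.
    have -> : c1 l * ((w.2 - u.2) * (v.1 - u.1)) = (c1 l * (v.1 - u.1)) * (w.2 - u.2) by ring.
    have -> : c1 l * (w.1 - u.1) = - (c2 l * (w.2 - u.2)) by lra.
    have -> : c1 l * (v.1 - u.1) = - (c2 l * (v.2 - u.2)) by lra.
    ring.
  have [c20|c20] := eqVneq (c2 l) 0.
    exfalso; apply: nz => w'; move: lu; rewrite /affine c10 c20 !mul0r => lu.
    by apply/eqP; lra.
  move: e1 e2; rewrite c10 !mul0r !add0r => /eqP; rewrite mulf_eq0 (negbTE c20) /= => /eqP ->.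
  by move=> /eqP; rewrite mulf_eq0 (negbTE c20) /= => /eqP ->; rewrite mulr0 mul0r.
suff : c1 l' * (w.1 - u.1) + c2 l' * (w.2 - u.2) = 0 by move: l'u; rewrite /affine; lra.
have [v1|v1] := eqVneq (v.1 - u.1) 0; last first.
  apply: (mulfI v1); rewrite mulr0.
  have -> : (v.1 - u.1) * (c1 l' * (w.1 - u.1) + c2 l' * (w.2 - u.2)) =
    (c1 l' * (v.1 - u.1)) * (w.1 - u.1) + c2 l' * ((w.2 - u.2) * (v.1 - u.1)) by ring.
  rewrite -cr; have -> : c1 l' * (v.1 - u.1) = - (c2 l' * (v.2 - u.2)) by lra.
  ring.
have [v2|v2] := eqVneq (v.2 - u.2) 0.
  case: uv; case: u v v1 v2 {lu lv l'u l'v e1 e2 e3 cr} => u1 u2 [v1 v2] /=.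
  by move=> /subr0_eq -> /subr0_eq ->.
move: e3; rewrite v1 mulr0 add0r => /eqP; rewrite mulf_eq0 (negbTE v2) orbF => /eqP ->.
move: cr; rewrite v1 mulr0 => /eqP; rewrite mulf_eq0 (negbTE v2) orbF => /eqP ->.
by rewrite mulr0 mul0r addr0.
Qed.

End HalfPlanePatterns.

(* Mark a quantile of the mass [q] along [r] at every multiple of [st]. *)
Lemma mass_marks (R : realType) (T : finType) (X : {set T}) (r q : T -> R) (zeta st : R) :
  0 < st -> 0 <= zeta -> (forall i, 0 <= q i) ->
  (forall i, i \in X -> \sum_(j in X | r j < r i) q j < zeta) ->
  exists M : {set T}, [/\ M \subset X, (#|M| <= (Num.truncn (zeta / st)).+2)%N &
    forall B : {set T}, B \subset X ->
     (forall a, a \in M -> (forall i, i \in B -> r a < r i) \/ (forall i, i \in B -> r i < r a)) ->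
     \sum_(i in B) q i <= st].
Proof.
move=> st0 z0 q0 hX; set N := (Num.truncn (zeta / st)).+2.
(* The cumulative mass up to [i]; the mark of level [k] is an [r]-least index whose cumulative mass
   exceeds [k%:R * st]. *)
pose F i := \sum_(j in X | r j <= r i) q j.
pose S (k : 'I_N) := [set i in X | k%:R * st < F i].
have mk (k : 'I_N) : exists a : option T, forall i, i \in S k ->
    if a is Some a' then a' \in S k /\ r a' <= r i else False.
  have [e|/(set_argmin r)[a aS ha]] := eqVneq (S k) set0.
    by exists None => i; rewrite e inE.
  by exists (Some a) => i iS; split=> //; apply: ha.
have [m hm] := choice mk.
pose M := [set a in X | [exists k, m k == Some a]].
exists M; split.
- by apply/subsetP => i; rewrite inE => /andP[].
- have : [set Some a | a in M] \subset [set m k | k in 'I_N].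
    apply/subsetP => o /imsetP[a]; rewrite inE => /andP[_ /existsP[k /eqP e]] ->.
    by rewrite -e; apply: imset_f.
  move/subset_leq_card; rewrite card_imset; last by move=> ? ? [].
  by move=> /leq_trans; apply; rewrite (leq_trans (leq_imset_card _ _)) // card_ord.
move=> B BX hB.
have [->|/(set_argmax r)[i0 i0B hi0]] := eqVneq B set0; first by rewrite big_set0 ltW.
have i0X := subsetP BX _ i0B.
have qsub (P Q : pred T) : (forall i, P i -> Q i) -> \sum_(i | P i) q i <= \sum_(i | Q i) q i.
  move=> PQ; rewrite big_mkcond [leRHS]big_mkcond ler_sum // => i _.
  by case: ifP => [/PQ -> //|_]; case: ifP.
have BF : \sum_(i in B) q i <= F i0.
  by apply: qsub => i iB; rewrite (subsetP BX) //; apply: hi0.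
have [Fst|Fst] := leP (F i0) st; first exact: le_trans BF Fst.
have N0 : (0 < N)%N by [].
pose pk k := (k < N)%N && (k%:R * st < F i0).
have ex : exists k, pk k by exists 0%N; rewrite /pk mul0r; apply: lt_trans Fst.
have bd k : pk k -> (k <= N)%N by case/andP => /ltnW.
case: (ex_maxnP ex bd) => k /andP[kN kF] kmax.
(* [k] is the highest level passed by the top element [i0] of [B]. Its mark [a] is not above [i0],
   hence lies strictly below all of [B]. *)
have i0S : i0 \in S (Ordinal kN) by rewrite inE i0X.
have := hm (Ordinal kN) i0 i0S; case e : (m _) => [a|//] [].
rewrite inE => /andP[aX Fa] rai.
have aM : a \in M by rewrite inE aX; apply/existsP; exists (Ordinal kN); rewrite e.
have {}hB : forall i, i \in B -> r a < r i.
  by case: (hB a aM) => // /(_ _ i0B); rewrite ltNge rai.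
have FaB : F a + \sum_(i in B) q i <= F i0.
  rewrite /F [leRHS](bigID (fun j => r j <= r a)) /= lerD //.
    apply: qsub => j /andP[jX ja]; rewrite jX ja (le_trans ja) //.
  apply: qsub => j jB; rewrite (subsetP BX) // -ltNge hB // andbT; exact: hi0.
have [kN'|kN'] := ltnP k.+1 N.
  have : F i0 <= k.+1%:R * st.
    by rewrite leNgt; apply/negP => h; have := kmax k.+1; rewrite /pk kN' h ltnn => /(_ isT).
  by move: Fa => /=; rewrite -natr1; lra.
(* At the last level the mass up to [a], which is strictly below [i0], would already exceed
   [zeta]. *)
have kE : k = (Num.truncn (zeta / st)).+1 by apply/eqP; rewrite eqn_leq -ltnS kN -ltnS.
have : zeta < k%:R * st.
  by rewrite -ltr_pdivrMr // kE truncnS_gt.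
have : F a <= \sum_(j in X | r j < r i0) q j.
  by apply: qsub => j /andP[-> ja] /=; rewrite (le_lt_trans ja) // hB.
by have := hX _ i0X; move: Fa => /=; lra.
Qed.

(** * Independent flips *)

Section Flips.
Variables (R : realType) (I : finType) (p : I -> R).
Hypothesis p01 : forall i, 0 < p i < 1.
Implicit Types (F : {ffun I -> bool}) (S : {set I}).

Definition flip_weight F : R := \prod_i (if F i then p i else 1 - p i).
Definition Pr (A : {ffun I -> bool} -> Prop) : R := \sum_(F | `[< A F >]) flip_weight F.
(** The log-density of the flip law tilted by [b] relative to the flip law itself; its exponential
    has mean 1. *)
Definition gain i (f : bool) b : R := f%:R * b - cgf (p i) b.

Lemma flip_weight_ge0 F : 0 <= flip_weight F.
Proof. by apply: prodr_ge0 => i _; have := p01 i; case: ifP => _ ?; lra. Qed.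

Lemma sum_flip_weight_prod (h : I -> bool -> R) :
  \sum_(F : {ffun I -> bool}) flip_weight F * \prod_i h i (F i) =
  \prod_i ((1 - p i) * h i false + p i * h i true).
Proof.
transitivity (\sum_(F : {ffun I -> bool}) \prod_i ((if F i then p i else 1 - p i) * h i (F i))).
  by apply: eq_bigr => F _; rewrite big_split.
rewrite -(bigA_distr_bigA (fun i f => (if f then p i else 1 - p i) * h i f)).
by apply: eq_bigr => i _; rewrite big_bool /=; ring.
Qed.

Lemma Pr_le A B : (forall F, A F -> B F) -> Pr A <= Pr B.
Proof.
move=> AB; rewrite /Pr big_mkcond [leRHS]big_mkcond ler_sum // => F _.
case: asboolP => [/AB h|_]; first by case: asboolP.
by case: asboolP => _ //; apply: flip_weight_ge0.
Qed.

Lemma Pr_or A B : Pr (fun F => A F \/ B F) <= Pr A + Pr B.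
Proof.
rewrite /Pr 3!(big_mkcond (fun F => `[< _ >])) -big_split ler_sum // => F _ /=.
have := flip_weight_ge0 F.
by do 3 case: asboolP => //; try tauto; lra.
Qed.

Lemma Pr_exists (J : finType) (D : {set J}) (A : J -> {ffun I -> bool} -> Prop) :
  Pr (fun F => exists2 j, j \in D & A j F) <= \sum_(j in D) Pr (A j).
Proof.
rewrite /Pr; under [leRHS]eq_bigr do rewrite big_mkcond.
rewrite exchange_big /= [leLHS]big_mkcond ler_sum // => F _.
have s0 (P : pred J) : 0 <= \sum_(j | P j) (if `[< A j F >] then flip_weight F else 0).
  by apply: sumr_ge0 => j _; case: ifP => // _; apply: flip_weight_ge0.
case: asboolP => [[j jD AjF]|_] //.
by rewrite (bigD1 j) //= asboolT // lerDl.
Qed.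

Lemma expR_gain i f b : expR (gain i f b) = expR (f%:R * b) / (1 - p i + p i * expR b).
Proof. by rewrite /gain expRB expR_cgf. Qed.

(** Markov's inequality for a product of independent factors of mean 1. *)
Lemma chernoff S (b : I -> R) y :
  Pr (fun F => y <= \sum_(i in S) gain i (F i) (b i)) <= expR (- y).
Proof.
have -> : expR (- y) = expR (- y) *
   \sum_(F : {ffun I -> bool}) flip_weight F * \prod_i (if i \in S then expR (gain i (F i) (b i)) else 1).
  rewrite (sum_flip_weight_prod (fun i f => if i \in S then expR (gain i f (b i)) else 1)).
  rewrite big1 ?mulr1 // => i _; case: ifP => _; last by ring.
  rewrite !expR_gain mul0r mul1r expR0; have := mgf_gt0 (b i) (p01 i) => h.
  by field; lra.
rewrite mulr_sumr /Pr big_mkcond ler_sum // => F _.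
rewrite -big_mkcond -expR_sum mulrCA -expRD.
have w0 := flip_weight_ge0 F.
case: asboolP => [h|_]; last by rewrite mulr_ge0 ?expR_ge0.
rewrite -[leLHS]mulr1 ler_wpM2l // leNgt expR_lt1 -leNgt; lra.
Qed.

Lemma Pr_agree S (tau : I -> bool) :
  Pr (fun F => forall i, i \in S -> F i = tau i) =
  expR (- \sum_(i in S) - ln (if tau i then p i else 1 - p i)).
Proof.
have -> : Pr (fun F => forall i, i \in S -> F i = tau i) =
   \sum_(F : {ffun I -> bool}) flip_weight F * \prod_i (if i \in S then (F i == tau i)%:R else 1).
  rewrite /Pr big_mkcond; apply: eq_bigr => F _; case: asboolP => h.
    rewrite big1 ?mulr1 // => i _; case: ifP => // iS.
    by rewrite h // eqxx.
  have [i iS ne] : exists2 i, i \in S & F i != tau i.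
    apply: contrapT => hn; apply: h => i iS; apply/eqP; apply: contrapT => /negP ne.
    by apply: hn; exists i.
  by rewrite (bigD1 i) //= iS (negbTE ne) mul0r mulr0.
rewrite (sum_flip_weight_prod (fun i f => if i \in S then (f == tau i)%:R else 1)).
rewrite sumrN opprK expR_sum [RHS]big_mkcond; apply: eq_bigr => i _.
case: ifP => _; last by ring.
have := p01 i => h; case: (tau i); rewrite lnK ?posrE /=; lra.
Qed.

Lemma Pr_flip S : Pr (fun F => exists2 i, i \in S & F i) <= \sum_(i in S) p i.
Proof.
apply: le_trans (Pr_exists _ _) _; rewrite ler_sum // => i _.
have := Pr_agree [set i] (fun=> true); rewrite big_set1 opprK lnK ?posrE; last first.
  by have := p01 i; lra.
by move=> <-; apply: Pr_le => F Fi j; rewrite inE => /eqP ->; rewrite Fi.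
Qed.

(** [chernoff] with the constant tilt [lam], using that each cumulant is at most
    [p i * expR lam]. *)
Lemma Pr_flips_ge S q (lam : R) : 0 <= lam ->
  Pr (fun F => (q <= #|[set i in S | F i]|)%N) <=
  expR (expR lam * \sum_(i in S) p i - lam * q%:R).
Proof.
move=> lam0; rewrite -[X in expR X]opprB.
apply: le_trans (chernoff S (fun=> lam) (lam * q%:R - expR lam * \sum_(i in S) p i)).
apply: Pr_le => F hq; rewrite /gain sumrB lerB //.
  rewrite -mulr_suml mulrC ler_wpM2r //.
  have -> : \sum_(i in S) (F i)%:R = #|[set i in S | F i]|%:R :> R.
    rewrite -sum1_card natr_sum big_mkcond [RHS]big_mkcond.
    by apply: eq_bigr => i _; rewrite inE; case: (i \in S); case: (F i).
  by rewrite ler_nat.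
rewrite mulr_sumr ler_sum // => i _; apply: le_trans (cgf_le _ (p01 i)) _.
by rewrite mulrC ler_wpM2r //; have := p01 i; lra.
Qed.

End Flips.

(** * Union bound over a grid inside the unsaturated window *)

Section Window.
Variables (R : realType) (I : finType) (p cap x y : I -> R).
Hypothesis p12 : forall i, 0 < p i <= 1 / 2.
Hypothesis cap1 : forall i, 1 <= cap i.
Hypothesis cap_ln : forall i, cap i <= 2 * - ln (p i).
Hypothesis cap_p : forall i, p i * cap i <= 1.
Implicit Types (S : {set I}) (w : R * R).

Let p01 i : 0 < p i < 1. Proof. by have := p12 i; lra. Qed.

Definition proj i w := x i * w.1 + y i * w.2.
Definition gap_sum S w := \sum_(i in S) cgap (p i) (proj i w).
Definition gain_sum S (F : {ffun I -> bool}) w := \sum_(i in S) gain p i (F i) (proj i w).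
Definition window S h w := forall i, i \in S -> - (2 * h) <= proj i w <= 2 * h * cap i.

Lemma gap_sum_ge0 S w : 0 <= gap_sum S w.
Proof. by apply: sumr_ge0 => i _; apply: cgap_ge0. Qed.

(** Bounds the cost of moving along the ray of [w] in either direction. Scaling by [4 * h] brings
    projections below [cap i] upward and below [1 / 2] in absolute value downward, where the
    reflection lemmas apply; star-shapedness at the origin gives the factor [|s|]. *)
Lemma ccgf_ray S h w s : 1 <= h -> window S h w -> `|s| <= 1 ->
  \sum_(i in S) ccgf (p i) (s * (proj i w / (4 * h))) <= `|s| * (128 * gap_sum S w).
Proof.
move=> h1 hw hs; rewrite /gap_sum !mulr_sumr ler_sum // => i iS.
have /andP[wl wu] := hw i iS.
set b := proj i w in wl wu *; have g0 := cgap_ge0 b (p01 i).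
have h0 : 0 < 4 * h by lra.
have c1 := cap1 i; have cl := cap_ln i; have cp := cap_p i; have pi := p12 i.
have [s0|s0] := leP 0 s.
  have hs' : 0 <= s <= 1 by move: hs; rewrite ger0_norm // => ->; rewrite s0.
  rewrite ger0_norm //; apply: le_trans (ccgf_star _ (p01 i) hs') _.
  rewrite ler_wpM2l //.
  have -> : b / (4 * h) = (4 * h)^-1 * b by rewrite mulrC.
  have h01 : 0 <= (4 * h)^-1 <= 1.
    by rewrite invr_ge0 ltW //= invf_le1 //; lra.
  apply: le_trans (ccgf_star _ (p01 i) h01) _.
  have := @ccgf_le_cgap _ (p i) b (2 * h) pi.
  have -> : 1 <= 2 * h by lra.
  have hb : b <= 2 * h * (2 * - ln (p i)).
    by apply: le_trans wu _; rewrite ler_wpM2l //; lra.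
  move=> /(_ isT wl hb) hc.
  rewrite mulrC ler_pdivrMr //; nra.
have hs' : 0 <= - s <= 1 by move: hs; rewrite ltr0_norm // => ->; lra.
rewrite ltr0_norm //.
have -> : s * (b / (4 * h)) = - s * - (b / (4 * h)) by rewrite mulrNN.
apply: le_trans (ccgf_star _ (p01 i) hs') _.
rewrite ler_wpM2l //; first lra.
have [b0|b0] := leP 0 b.
  have q0 : 0 <= b / (4 * h) by rewrite divr_ge0 // ltW.
  have qb : b / (4 * h) <= b by rewrite ler_pdivrMr //; nra.
  have qc : b / (4 * h) <= cap i by rewrite ler_pdivrMr //; nra.
  apply: ccgf_reflect_pos => //; first by rewrite q0.
  by apply: le_trans cp; rewrite ler_wpM2l //; lra.
rewrite -mulNr; apply: ccgf_reflect_neg => //; first exact: ltW.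
- by apply/andP; split; [rewrite divr_ge0; lra | rewrite ler_pdivrMr //; lra].
- by rewrite ler_pdivrMr //; nra.
Qed.

(* Among the finitely many maximizers pick a spanning pair; in these
   coordinates a grid of spacing of order [1 / h] is fine enough, because the
   window makes the centered cumulant symmetric up to the scale [4 * h]. *)
Lemma Pr_window S h z t (N : nat) : 1 <= h -> 0 < z -> 32 * (16 * (16 * h)) <= N%:R ->
  Pr p (fun F => exists w, [/\ window S h w, gap_sum S w < z & t <= gain_sum S F w])
  <= (2 * N + 2)%:R ^+ 2 * expR (- (t / 2 - z / 16)).
Proof.
move=> h1 z0 hN.
pose good F w := [/\ window S h w, gap_sum S w < z & t <= gain_sum S F w].
have N0 : 0 < N%:R :> R by lra.
have ch F : exists w, (exists w', good F w') -> good F w.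
  by have [[w' hw]|h'] := pselect (exists w', good F w'); [exists w'|exists (0, 0)].
have [wF hwF] := choice ch.
pose Bad := [set F | `[< exists w, good F w >]].
have [B0|Bn0] := eqVneq Bad set0.
  have -> : Pr p (fun F => exists w, good F w) = 0.
    rewrite /Pr big_pred0 // => F; move/setP: B0 => /(_ F); by rewrite !inE.
  by rewrite mulr_ge0 ?expR_ge0 // sqr_ge0.
(* The pair is chosen among the witnesses of all bad outcomes, so [a] and [b] do not depend on the
   random outcome and the grid is deterministic. *)
have [Fa [Fb [Fa_bad Fb_bad span]]] := spanning_pair (fun F => (wF F).1) (fun F => (wF F).2) Bn0.
have goodF F : F \in Bad -> good F (wF F) by rewrite inE => /asboolP; apply: hwF.
set a := wF Fa in span; set b := wF Fb in span.
have [wa ga _] := goodF _ Fa_bad; have [wb gb _] := goodF _ Fb_bad.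
rewrite -/a in wa ga; rewrite -/b in wb gb.
pose c (k : 'I_(2 * N + 2)) : R := k%:R / N%:R - 1.
pose u (k : 'I_(2 * N + 2) * 'I_(2 * N + 2)) : R * R :=
  ((c k.1 * a.1 + c k.2 * b.1) / 2, (c k.1 * a.2 + c k.2 * b.2) / 2).
(* The coefficient is rounded in the direction that does not decrease the linear part, so only the
   cumulant pays for rounding. *)
have grid (al s : R) : `|al| <= 1 -> exists k, al * s <= c k * s /\ `|c k - al| <= N%:R^-1.
  move=> hal; have {hal} : -1 <= al <= 1 by rewrite -ler_norml.
  move=> hal; have q0 : 0 <= (al + 1) * N%:R by rewrite mulr_ge0 //; lra.
  set k := Num.truncn ((al + 1) * N%:R).
  have kle : k%:R <= (al + 1) * N%:R by rewrite Num.Theory.truncn_le.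
  have klt : (al + 1) * N%:R < k.+1%:R by rewrite truncnS_gt.
  have kN : (k <= 2 * N)%N.
    rewrite -(ler_nat R); apply: le_trans kle _; rewrite natrM ler_wpM2r //; lra.
  have k1 : (k < 2 * N + 2)%N by rewrite addn2 ltnS leqW.
  have k2 : (k.+1 < 2 * N + 2)%N by rewrite addn2 !ltnS.
  have e1 : k%:R / N%:R <= al + 1 by rewrite ler_pdivrMr.
  have e2 : al + 1 < k.+1%:R / N%:R by rewrite ltr_pdivlMr.
  have e3 : k.+1%:R / N%:R = k%:R / N%:R + N%:R^-1 :> R by rewrite -natr1 mulrDl mul1r.
  have [s0|s0] := leP 0 s.
    exists (Ordinal k2); rewrite /c /=; split; first by rewrite ler_wpM2r //; lra.
    by rewrite ler_norml; lra.
  exists (Ordinal k1); rewrite /c /=; split; first by rewrite ler_wnM2r //; lra.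
  by rewrite ler_norml; lra.
have ray w d : window S h w -> gap_sum S w < z -> `|d| <= N%:R^-1 ->
   \sum_(i in S) ccgf (p i) (2 * d * proj i w) <= z / 8.
  move=> ww gw dN.
  have dN' : `|8 * h * d| * 128 <= 1 / 8.
    rewrite normrM ger0_norm; last lra.
    have : 8 * h * `|d| <= 8 * h * N%:R^-1 by rewrite ler_wpM2l //; lra.
    have : 8 * h * N%:R^-1 <= 1 / (32 * 32) by rewrite ler_pdivrMr //; lra.
    lra.
  have := @ccgf_ray S h w (8 * h * d) h1 ww ltac:(lra).
  have g0 := gap_sum_ge0 S w.
  have -> : \sum_(i in S) ccgf (p i) (8 * h * d * (proj i w / (4 * h))) =
     \sum_(i in S) ccgf (p i) (2 * d * proj i w).
    by apply: eq_bigr => i _; congr ccgf; field; lra.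
  move=> /le_trans; apply; rewrite mulrA.
  apply: le_trans (_ : 1 / 8 * gap_sum S w <= _); first by rewrite ler_wpM2r.
  lra.
apply: (@le_trans _ _ (\sum_(k in [set: 'I_(2 * N + 2) * 'I_(2 * N + 2)])
   Pr p (fun F => t / 2 - z / 16 <= gain_sum S F (u k)))); last first.
  apply: (@le_trans _ _ (\sum_(k in [set: 'I_(2 * N + 2) * 'I_(2 * N + 2)])
    expR (- (t / 2 - z / 16)))).
    by apply: ler_sum => k _; apply: chernoff.
  by rewrite sumr_const cardsT card_prod card_ord -[leLHS]mulr_natl natrM expr2.
apply: le_trans (Pr_exists p01 _ _); apply: Pr_le => // F [w hw].
have FB : F \in Bad by rewrite inE; apply/asboolP; exists w.
have [{hw}ww gw tw] := goodF _ FB; have [al [be [hal hbe ex ey]]] := span F FB.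
set v := wF F in ww gw tw ex ey.
pose lin w' := \sum_(i in S) ((F i)%:R - p i) * proj i w'.
have [k1 [hk1 dk1]] := grid al (lin a) hal.
have [k2 [hk2 dk2]] := grid be (lin b) hbe.
exists (k1, k2) => //.
have gainE w' : gain_sum S F w' = lin w' - \sum_(i in S) ccgf (p i) (proj i w').
  rewrite /gain_sum /lin -sumrB; apply: eq_bigr => i _.
  by rewrite /gain /ccgf; ring.
have linD s1 s2 : lin ((s1 * a.1 + s2 * b.1), (s1 * a.2 + s2 * b.2)) = s1 * lin a + s2 * lin b.
  rewrite /lin !mulr_sumr -big_split; apply: eq_bigr => i _.
  by rewrite /proj /=; ring.
have linv : lin v = al * lin a + be * lin b.
  by rewrite -linD; congr lin; rewrite -ex -ey; case: (v).
have linu : lin (u (k1, k2)) = (c k1 * lin a + c k2 * lin b) / 2.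
  by rewrite -linD /lin mulr_suml; apply: eq_bigr => i _; rewrite /proj /u /=; field.
(* The grid point is the midpoint of [v] and a rounding error, itself a midpoint along [a] and [b].
   Convexity used twice keeps half the gain and loses at most [z / 16]. *)
have phiu : \sum_(i in S) ccgf (p i) (proj i (u (k1, k2))) <=
   (\sum_(i in S) ccgf (p i) (proj i v)) / 2 +
   ((\sum_(i in S) ccgf (p i) (2 * (c k1 - al) * proj i a)) / 2 +
   (\sum_(i in S) ccgf (p i) (2 * (c k2 - be) * proj i b)) / 2) / 2.
  rewrite !mulr_suml -!big_split /= mulr_suml -big_split ler_sum //= => i _.
  have -> : proj i (u (k1, k2)) = (proj i v +
    (2 * (c k1 - al) * proj i a + 2 * (c k2 - be) * proj i b) / 2) / 2.
    by rewrite /proj ex ey /u /=; field.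
  apply: le_trans (ccgf_mid _ _ (p01 i)) _; rewrite lerD2l.
  by rewrite ler_wpM2r //; apply: ccgf_mid.
have := ray a _ wa ga dk1; have := ray b _ wb gb dk2.
move: tw; rewrite !gainE linu linv; lra.
Qed.

End Window.

(** * Saturated indices *)

Section FlipRate.
Variable R : realType.
Implicit Types m : R.

Definition flip_rate m : R := (1 + expR m)^-1.

Lemma flip_rate_gt0 m : 0 < flip_rate m.
Proof. by rewrite invr_gt0; have := expR_gt0 m; lra. Qed.

Lemma flip_rate_le m : 0 <= m -> flip_rate m <= 1 / 2.
Proof.
move=> m0; rewrite /flip_rate div1r lef_pV2 ?posrE //.
have : 1 <= expR m by rewrite leNgt expR_lt1 -leNgt.
lra.
Qed.

Lemma flip_rate_expR m : flip_rate m * expR m <= 1.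
Proof. by rewrite mulrC ler_pdivrMr ?mul1r; have := expR_gt0 m; lra. Qed.

Lemma ln_flip_rate m : - ln (flip_rate m) = ln (1 + expR m).
Proof. by rewrite lnV ?opprK // posrE; have := expR_gt0 m; lra. Qed.

Lemma ln_flip_rate_ge m : m <= - ln (flip_rate m).
Proof.
rewrite ln_flip_rate -[leLHS]expRK ler_ln ?posrE ?expR_gt0 //; have := expR_gt0 m; lra.
Qed.

Lemma ln_flip_rate_half m : 0 <= m -> 1 / 2 <= - ln (flip_rate m).
Proof.
move=> m0; rewrite ln_flip_rate.
have e1 : 1 <= expR m by rewrite leNgt expR_lt1 -leNgt.
apply: le_trans (ln1D_ge _); last lra.
by rewrite ler_pdivlMr; lra.
Qed.

Lemma ln_flip_rate_le m : 0 <= m -> - ln (flip_rate m) <= m + 1.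
Proof.
move=> m0; rewrite ln_flip_rate -[leRHS]expRK ler_ln ?posrE ?expR_gt0 //.
rewrite expRD; have e1 : 1 <= expR m by rewrite leNgt expR_lt1 -leNgt.
have := expR_ge1Dx (1 : R); nra.
Qed.

Lemma flip_rate_cap m : 0 <= m -> flip_rate m * Num.max 1 m <= 1.
Proof.
move=> m0; rewrite /flip_rate mulrC ler_pdivrMr; last by have := expR_gt0 m; lra.
rewrite mul1r ge_max; have := expR_ge1Dx m; lra.
Qed.

Lemma cap_flip_rate m : 0 <= m -> Num.max 1 m <= 2 * - ln (flip_rate m).
Proof.
move=> m0; have := ln_flip_rate_half m0; have := ln_flip_rate_ge m.
by rewrite ge_max; lra.
Qed.

Lemma flip_rate_ge m : m < 1 -> 1 / 5 <= flip_rate m.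
Proof.
move=> m1; rewrite /flip_rate div1r lef_pV2 ?posrE //.
suff : expR m <= 4 by lra.
by apply: le_trans (expR1_le4 R); rewrite ler_expR ltW.
Qed.

End FlipRate.

(** * Describing saturation by few lines at points of small gap *)

Section Patterns.
Variables (R : realType) (I : finType) (m x y : I -> R).
Hypothesis m0 : forall i, 0 <= m i.
Hypothesis xm : forall i, 1 <= m i -> x i = m i.
Variables (z xi st : R) (K t : nat).
Hypotheses (z1 : 1 <= z) (xi2 : 2 <= xi) (ht : 5 * (64 * z) <= t%:R).
Implicit Types (i j a : I) (w : R * R) (pi : {set I * bool}).

Let p i := flip_rate (m i).
Let cap i := Num.max 1 (m i).
Let b := proj x y.
Let r i := y i / m i.
Let J w := gap_sum p x y [set: I] w.
Let H := 64 * z.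

Variable lev : I -> nat.
Hypothesis levP : forall i, 1 <= m i < 2 ^+ K ->
  (lev i < K)%N /\ 2 ^+ lev i <= m i < 2 ^+ (lev i).+1.
Variables (X0 Xp M : {set I}).

(* [r i] orders the indices of one dyadic level: on [0 <= w.2] the sign of
   [b i w] is that of [w.1 + r i * w.2], which is monotone in [r i].  Indices
   outside [low_class] have too much mass below them in this order to be
   saturated at a point of small gap. *)
Definition near_class := [set i | m i < 1].
Definition mid_class := [set i | 1 <= m i < 2 ^+ K].
Definition far_class := [set i | 2 ^+ K <= m i].
Definition low_class := [set i in mid_class |
  \sum_(j in mid_class | (lev j == lev i) && (r j < r i)) p j < 32 * z].

(** Saturation outside [X0] forces it at [t] members of [X0], whose gaps alone would total [z];
    [Xp_dom] plays the same role upward in the dyadic range. *)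
Hypothesis X0_dom : forall w i, i \in near_class :\: X0 -> 2 * H < `|b i w| ->
  (t <= #|[set j in X0 | `[< (H < `|b j w|)%R >]]|)%N.
Hypothesis X0_near : X0 \subset near_class.
Hypothesis Xp_mid : Xp \subset mid_class.
Hypothesis Xp_dom : forall w i, i \in mid_class :\: Xp -> 0 <= w.2 /\ H * m i < b i w ->
  (t <= #|[set j in Xp | `[< (H * m j < b j w)%R >]]|)%N.
Hypothesis M_low : M \subset low_class.
Hypothesis M_gap : forall k (B : {set I}), B \subset [set i in low_class | lev i == k] ->
  (forall a, a \in M -> lev a = k ->
     (forall i, i \in B -> r a < r i) \/ (forall i, i \in B -> r i < r a)) ->
  \sum_(i in B) p i <= st.

Let p12 i : 0 < p i <= 1 / 2.
Proof. by rewrite flip_rate_gt0 flip_rate_le. Qed.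
Let p01 i : 0 < p i < 1. Proof. by have := p12 i; lra. Qed.
Let gap0 i w : 0 <= cgap (p i) (b i w). Proof. exact: cgap_ge0. Qed.
Let H4 : 64 <= H. Proof. by rewrite /H; have := z1; lra. Qed.
Let cap_ge1 i : 1 <= cap i. Proof. by rewrite /cap le_max lexx. Qed.

(* The line [(i, true)] tests upward saturation, [(i, false)] downward. *)
Definition skew i := if m i < 1 then 1 else m i / 2 ^+ lev i.
Definition line0 (l : I * bool) := H * (if l.2 then cap l.1 else skew l.1).
Definition line1 (l : I * bool) := if l.2 then x l.1 else - x l.1.
Definition line2 (l : I * bool) := if l.2 then y l.1 else - y l.1.
Definition lines := [set l : I * bool | l.1 \in (if l.2 then X0 :|: Xp else X0 :|: M)].
Definition cell w := pattern line0 line1 line2 lines w.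

Lemma cell_pos i w : i \in X0 :|: Xp -> ((i, true) \in cell w) = (H * cap i < b i w).
Proof. by move=> h; rewrite !inE /= -in_setU h /= /affine /line0 /line1 /line2 /= subr_gt0. Qed.

Lemma cell_neg i w : i \in X0 :|: M -> ((i, false) \in cell w) = (b i w < - (H * skew i)).
Proof.
move=> h; rewrite !inE /= -in_setU h /= /affine /line0 /line1 /line2 /= /b /proj.
by apply/idP/idP => ?; lra.
Qed.

(* [blur pi] collects the indices between two consecutive marks of [M], whose
   saturation the pattern [pi] leaves undecided. *)
Definition sat_low pi := [set i in X0 | (i, false) \in pi] :|:
  [set i in low_class | [exists a in M, [&& (a, false) \in pi, lev a == lev i & r i <= r a]]].
Definition blur pi := [set i in low_class :\: sat_low pi |
  [forall a in M, ((a, false) \notin pi) && (lev a == lev i) ==> (r i < r a)]].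
Definition sat_high pi := [set i in X0 :|: Xp | (i, true) \in pi] :\: blur pi.
Definition saturated pi := sat_low pi :|: sat_high pi.
Definition regular pi := (near_class :|: mid_class) :\: (saturated pi :|: blur pi).

Lemma mid_proj i w : 1 <= m i -> b i w = m i * (w.1 + r i * w.2).
Proof. by move=> h; rewrite /b /proj /r (xm h); field; lra. Qed.

Lemma mid_lev i : i \in mid_class ->
  [/\ 1 <= m i, (lev i < K)%N, 0 < (2 : R) ^+ lev i, 2 ^+ lev i <= m i & m i < 2 * 2 ^+ lev i].
Proof.
rewrite inE => h; have [h1 /andP[h2 h3]] := levP h; case/andP: h => h _.
by split=> //; rewrite -exprS.
Qed.

Lemma gap_sub (A : {set I}) w : \sum_(i in A) cgap (p i) (b i w) <= J w.
Proof.
rewrite /J /gap_sum /= [leLHS]big_mkcond [leRHS]big_mkcond; apply: ler_sum => i _.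
by rewrite in_setT; case: ifP => // _; apply: gap0.
Qed.

Lemma gap_count (A : {set I}) w (c : R) : J w < z -> 0 <= c -> z <= c * t%:R ->
  (forall i, i \in A -> c <= cgap (p i) (b i w)) -> (t <= #|A|)%N -> False.
Proof.
move=> Jz c0 zc hA tA; suff : z <= J w by lra.
apply: le_trans (gap_sub A w); apply: le_trans zc _.
apply: (@le_trans _ _ (\sum_(i in A) c)); last exact: ler_sum.
by rewrite sumr_const -[leRHS]mulr_natr ler_wpM2l // ler_nat.
Qed.

Lemma sat_pos_gap i w : 4 * cap i <= b i w -> - ln (p i) <= 64 * cgap (p i) (b i w).
Proof.
move=> hb; have c1 := cap_ge1 i; apply: cgap_sat_pos => //; first lra.
have : expR (2 * cap i) <= expR (b i w / 2) by rewrite ler_expR; lra.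
have -> : 2 * cap i = cap i + cap i by lra.
rewrite expRD => h.
have e1 : 1 + expR (m i) <= expR (cap i) * expR (cap i).
  have : expR (m i) <= expR (cap i) by rewrite ler_expR /cap le_max lexx orbT.
  have := expR_ge1Dx (cap i); nra.
rewrite /p /flip_rate mulrC ler_pdivlMr ?mul1r; first exact: le_trans e1 h.
by have := expR_gt0 (m i); lra.
Qed.

Lemma sat_neg_gap i w : b i w <= - 2 -> - ln (1 - p i) <= 64 * cgap (p i) (b i w).
Proof. exact: cgap_sat_neg. Qed.

(** Thanks to [skew], a downward line at a mark [a] tests [w.1 + r a * w.2] against
    [- H / 2 ^+ lev a], a threshold common to the level. With [0 <= w.2] the test passes to every
    smaller [r i]. *)
Lemma sat_low_lt w i : 0 <= w.2 -> i \in sat_low (cell w) -> b i w < - H.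
Proof.
move=> w2; rewrite inE => /orP[|].
  rewrite inE => /andP[iX]; rewrite cell_neg; last by rewrite inE iX.
  by move/(subsetP X0_near): iX; rewrite inE /skew => ->; rewrite mulr1.
rewrite inE => /andP[iL /existsP[a /and4P[aM an /eqP la ra]]].
move: an; rewrite cell_neg ?inE ?aM ?orbT //.
have /(subsetP M_low) aL := aM.
have : i \in mid_class by move: iL; rewrite inE => /andP[].
have : a \in mid_class by move: aL; rewrite inE => /andP[].
move=> /mid_lev[ma _ La La1 La2] /mid_lev[mi _ Li Li1 Li2].
rewrite /skew (ltNge (m a)) ma /= !mid_proj //; rewrite la in La La1 La2 *.
set L := 2 ^+ lev i in La La1 La2 Li Li1 Li2 *.
have -> : - (H * (m a / L)) = m a * (- (H / L)) by field; lra.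
rewrite ltr_pM2l; last lra.
move=> h.
have : w.1 + r i * w.2 < - (H / L) by apply: le_lt_trans h; rewrite lerD2l ler_wpM2r.
move=> {}h; apply: (@lt_le_trans _ _ (m i * - (H / L))); first by (rewrite ltr_pM2l //; lra).
by rewrite mulrN lerN2 mulrA ler_pdivlMr // [leRHS]mulrC ler_wpM2l //; have := H4; lra.
Qed.

Lemma sat_high_gt w i : i \in sat_high (cell w) -> H * cap i < b i w.
Proof. by rewrite !inE => /andP[_ /andP[iX]]; rewrite -cell_pos ?inE // => ->; rewrite iX. Qed.

(** An index that escapes the window is detected by its own line, or by a mark of its level, or else
    forces a gap of at least [z]. *)
Lemma regular_window w : 0 <= w.2 -> J w < z ->
  window cap x y (regular (cell w)) H w.
Proof.
move=> w2 Jz i; rewrite inE => /andP[iS iC].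
have hH := H4; have hz := z1; have htz := ht.
have [ns nb] : i \notin saturated (cell w) /\ i \notin blur (cell w).
  by move: iS; rewrite inE negb_or => /andP[].
have [nl nh] : i \notin sat_low (cell w) /\ i \notin sat_high (cell w).
  by move: ns; rewrite inE negb_or => /andP[].
rewrite -/b; have c1 := cap_ge1 i.
have Hc : H <= H * cap i by rewrite ler_peMr; lra.
have high : i \in X0 :|: Xp -> b i w <= 2 * H * cap i.
  move=> iX; have : ~~ (H * cap i < b i w).
    rewrite -cell_pos //; apply: contra nh => h.
    by rewrite /sat_high in_setD nb in_set iX h.
  rewrite -leNgt; lra.
case iC0 : (i \in near_class).
  have [iX|iX] := boolP (i \in X0).
    rewrite high ?inE ?iX // andbT.
    have : ~~ (b i w < - (H * skew i)).
      rewrite -cell_neg; last by rewrite inE iX.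
      apply: contra nl => h.
      by rewrite /sat_low in_setU; apply/orP; left; rewrite in_set iX.
    have -> : skew i = 1 by move: iC0; rewrite inE /skew => ->.
    rewrite mulr1 -leNgt; lra.
  have : `|b i w| <= 2 * H.
    rewrite leNgt; apply/negP => hb.
    have := X0_dom (w := w) (i := i); rewrite inE iX iC0 => /(_ isT hb) tc.
    (* An upward saturated [j] has gap at least [1 / 128]; a downward one has flip rate at least
       [1 / 5], hence gap at least [1 / (5 * 64)]. *)
    apply: (@gap_count _ w (1 / (5 * 64)) Jz _ _ _ tc); try lra.
    move=> j; rewrite inE => /andP[/(subsetP X0_near) jX /asboolP].
    rewrite inE in jX; rewrite ltr_normr => /orP[] hj.
      have : 4 * cap j <= b j w by rewrite /cap maxEle (lt_geF jX) //; lra.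
      by move=> /sat_pos_gap; have := ln_flip_rate_half (m0 j); rewrite -/(p j); lra.
    have /sat_neg_gap : b j w <= - 2 by lra.
    have : p j <= - ln (1 - p j).
      have pj := p12 j; have := @le_ln1Dx R (- p j); lra.
    by have := flip_rate_ge jX; rewrite -/(p j); lra.
  rewrite ler_norml => /andP[-> hb] /=; nra.
have iM : i \in mid_class by move: iC; rewrite inE iC0.
have [mi Ki Li Li1 Li2] := mid_lev iM.
have capi : cap i = m i by rewrite /cap maxEle mi.
apply/andP; split; last first.
  have [iX|iX] := boolP (i \in Xp); first by rewrite high // inE iX orbT.
  suff : b i w <= H * m i by rewrite capi; nra.
  rewrite leNgt; apply/negP => hb.
  have := Xp_dom (w := w) (i := i); rewrite inE iX iM => /(_ isT (conj w2 hb)) tc.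
  apply: (@gap_count _ w (1 / (5 * 64)) Jz _ _ _ tc); try lra.
  move=> j; rewrite inE => /andP[/(subsetP Xp_mid) jX /asboolP hj].
  have [mj _ _ _ _] := mid_lev jX.
  have : 4 * cap j <= b j w by rewrite /cap maxEle mj; nra.
  by move=> /sat_pos_gap; have := ln_flip_rate_half (m0 j); rewrite -/(p j); lra.
have [iL|iL] := boolP (i \in low_class).
  (* Since [i] is neither saturated nor blurred, some unsaturated mark of its level lies at or below
     it and bounds [b i w] from below. *)
  have [a [aM an la ra]] : exists a, [/\ a \in M, (a, false) \notin cell w, lev a = lev i & r a <= r i].
    move: nb; rewrite inE (_ : i \in low_class :\: _); last by rewrite inE nl iL.
    rewrite /= negb_forall => /existsP[a]; rewrite !negb_imply -leNgt => /and3P[aM /andP[an /eqP la] ra].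
    by exists a.
  have /(subsetP M_low) aL := aM.
  have : a \in mid_class by move: aL; rewrite inE => /andP[].
  move=> /mid_lev[ma _ La La1 La2].
  move: an; rewrite cell_neg ?inE ?aM ?orbT // -leNgt /skew (ltNge (m a)) ma /= !mid_proj //.
  rewrite la in La La1 La2 *; set L := 2 ^+ lev i in La La1 La2 Li Li1 Li2 *.
  have -> : - (H * (m a / L)) = m a * (- (H / L)) by field; lra.
  rewrite ler_pM2l; last lra.
  move=> h.
  have {}h : - (H / L) <= w.1 + r i * w.2 by apply: le_trans h _; rewrite lerD2l ler_wpM2r.
  apply: (@le_trans _ _ (m i * - (H / L))); last by rewrite ler_pM2l //; lra.
  rewrite mulrN lerN2 mulrA ler_pdivrMr //; nra.
(* Mass at least [32 * z] lies below [i] on its level; all of it would be pushed below [- 2], with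
   gap at least [p j / 32] each. *)
rewrite leNgt; apply/negP => hb.
suff : z <= J w by lra.
have : 32 * z <= \sum_(j in mid_class | (lev j == lev i) && (r j < r i)) p j.
  by move: iL; rewrite inE iM /= -leNgt.
move=> hmass; have : \sum_(j in mid_class | (lev j == lev i) && (r j < r i)) p j / 32 <=
   \sum_(j in [set j in mid_class | (lev j == lev i) && (r j < r i)]) cgap (p j) (b j w).
  rewrite [leRHS](eq_bigl (fun j => (j \in mid_class) && ((lev j == lev i) && (r j < r i)))); last first.
    by move=> j; rewrite inE.
  apply: ler_sum => j /andP[jM /andP[/eqP lj rj]]; apply: cgap_neg_big => //.
  have [mj _ Lj Lj1 Lj2] := mid_lev jM.
  move: hb; rewrite !mid_proj //; rewrite lj in Lj Lj1 Lj2.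
  set L := 2 ^+ lev i in Lj Lj1 Lj2 Li Li1 Li2 *.
  move=> hb.
  have hw : w.1 + r i * w.2 < - (H / L).
    have h2 : m i * (w.1 + r i * w.2) < m i * (- (H / L)).
      apply: lt_le_trans hb _; rewrite mulrN lerN2 mulrA ler_pdivrMr //; nra.
    by rewrite ltr_pM2l in h2; lra.
  have : w.1 + r j * w.2 < - (H / L).
    by apply: le_lt_trans hw; rewrite lerD2l ler_wpM2r // ltW.
  have HL : L * (H / L) = H by field; lra.
  have HL0 : 0 < H / L by rewrite divr_gt0 //; lra.
  nra.
rewrite -mulr_suml => h2; have := gap_sub [set j in mid_class | (lev j == lev i) && (r j < r i)] w.
lra.
Qed.

Lemma sum_level (A : {set I}) (f : I -> R) : (forall i, i \in A -> (lev i < K)%N) ->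
  \sum_(i in A) f i = \sum_(k < K) \sum_(i in [set i in A | lev i == k]) f i.
Proof.
move=> AK; transitivity (\sum_(k < K) \sum_(i in A) if lev i == k then f i else 0).
  rewrite exchange_big; apply: eq_bigr => i iA.
  rewrite (bigD1 (Ordinal (AK i iA))) //= eqxx big1 ?addr0 // => k.
  move=> /negP hk; have [e|//] := eqVneq (lev i) k; case: hk.
  by apply/eqP/val_inj.
apply: eq_bigr => k _; rewrite -big_mkcondr; apply: eq_bigl => i; by rewrite inE.
Qed.

(** On each level the blur lies above every mark declared saturated and below every other one, so
    [M_gap] applies level by level. *)
Lemma blur_mass pi : \sum_(i in blur pi) p i <= K%:R * st.
Proof.
have bm i : i \in blur pi -> i \in low_class by rewrite !inE => /andP[/andP[_ ->]].
have bK i : i \in blur pi -> (lev i < K)%N.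
  by move=> /bm; rewrite inE => /andP[/mid_lev[]].
rewrite (sum_level _ bK).
have : \sum_(k < K) \sum_(i in [set i in blur pi | lev i == k]) p i <= \sum_(k < K) st.
  apply: ler_sum => k _; apply: (M_gap (k := k)).
    by apply/subsetP => i; rewrite in_set => /andP[/bm iL li]; rewrite in_set iL.
  move=> a aM la.
  have [an|an] := boolP ((a, false) \in pi).
    left => i; rewrite inE => /andP[iB /eqP li].
    rewrite ltNge; apply/negP => ra; move: iB; rewrite inE => /andP[].
    rewrite inE => /andP[ns iL] _; move/negP: ns; apply.
    rewrite inE; apply/orP; right; rewrite inE iL /=; apply/existsP; exists a.
    by rewrite aM an la li eqxx ra.
  right => i; rewrite inE => /andP[iB /eqP li].
  move: iB; rewrite inE => /andP[_ /forallP/(_ a)].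
  by rewrite aM an la li eqxx.
by move=> /le_trans; apply; rewrite sumr_const card_ord -[leLHS]mulr_natl.
Qed.

(* A non-risky index has enough mass above it that [b i w >= 2 * xi] would
   make the gap at least [z]; a flip of it thus gains at most [2 * xi]. *)
Definition risky := [set i in mid_class | (xi <= m i) &&
  (\sum_(j in mid_class | [&& lev j == lev i, xi <= m j & r i <= r j]) p j
     <= 128 * z * expR (- xi))].

(** On each level the upper mass of the [r]-least risky index already counts all the risky ones. *)
Lemma risky_mass : \sum_(i in risky) p i <= K%:R * (128 * z * expR (- xi)).
Proof.
have rK i : i \in risky -> (lev i < K)%N by rewrite inE => /andP[/mid_lev[]].
have c0 : 0 <= 128 * z * expR (- xi) by rewrite mulr_ge0 ?expR_ge0 //; have := z1; lra.
rewrite (sum_level _ rK).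
have : \sum_(k < K) \sum_(i in [set i in risky | lev i == k]) p i <=
    \sum_(k < K) (128 * z * expR (- xi)).
  apply: ler_sum => k _.
  have [->|/(set_argmin r)[i0 i0A hi0]] := eqVneq [set i in risky | lev i == k] set0.
    by rewrite big_set0.
  have : i0 \in risky by move: i0A; rewrite in_set => /andP[].
  rewrite inE => /and3P[_ _]; apply: le_trans.
  rewrite big_mkcond [leRHS]big_mkcond; apply: ler_sum => i _.
  case: ifP => iA; last by case: ifP => // _; have := p01 i; lra.
  have ri := hi0 _ iA.
  move: iA i0A; rewrite !in_set => /andP[/andP[iM /andP[mx _]] /eqP ->] /andP[_ /eqP ->].
  by rewrite iM mx eqxx ri.
by move=> /le_trans; apply; rewrite sumr_const card_ord -[leLHS]mulr_natl.
Qed.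

Lemma not_risky_lt w i : 0 <= w.2 -> J w < z -> i \in mid_class -> xi <= m i ->
  i \notin risky -> b i w < 2 * xi.
Proof.
move=> w2 Jz iM mxi; rewrite inE iM mxi /= -ltNge => hmass.
rewrite ltNge; apply/negP => hb.
have hx := xi2; have [mi _ Li Li1 Li2] := mid_lev iM.
suff : z <= J w by lra.
have ex : 0 < expR (- xi) := expR_gt0 _.
have : \sum_(j in mid_class | [&& lev j == lev i, xi <= m j & r i <= r j])
     p j * (expR xi / 128) <=
   \sum_(j in [set j in mid_class | [&& lev j == lev i, xi <= m j & r i <= r j]])
     cgap (p j) (b j w).
  rewrite [leRHS](eq_bigl (fun j => (j \in mid_class) &&
    [&& lev j == lev i, xi <= m j & r i <= r j])); last by move=> j; rewrite inE.
  apply: ler_sum => j /andP[jM /and3P[/eqP lj xj rj]].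
  have [mj _ Lj Lj1 Lj2] := mid_lev jM; rewrite lj in Lj Lj1 Lj2.
  rewrite mulrA; apply: cgap_mass => //.
    move: hb; rewrite !mid_proj //.
    set L := 2 ^+ lev i in Lj Lj1 Lj2 Li Li1 Li2 *.
    have : w.1 + r i * w.2 <= w.1 + r j * w.2 by rewrite lerD2l ler_wpM2r.
    move=> h hb.
    have u0 : 0 < w.1 + r i * w.2.
      by rewrite ltNge; apply/negP => h0; have := mulr_ge0_le0 (m0 i) h0; lra.
    apply: (@le_trans _ _ (m j * (w.1 + r i * w.2))); last by rewrite ler_wpM2l.
    (* Margins of one level differ by a factor below 2, so [b j w] is at least half of [b i w]. *)
    have : m i * (w.1 + r i * w.2) <= 2 * m j * (w.1 + r i * w.2).
      by rewrite ler_wpM2r; lra.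
    lra.
  apply: le_trans (flip_rate_expR (m j)).
  by rewrite ler_wpM2l ?ler_expR // ltW // flip_rate_gt0.
rewrite -mulr_suml => h2.
have := gap_sub [set j in mid_class | [&& lev j == lev i, xi <= m j & r i <= r j]] w.
move/(le_trans h2); apply: le_trans.
have : 128 * z * expR (- xi) * (expR xi / 128) <=
  (\sum_(j in mid_class | [&& lev j == lev i, xi <= m j & r i <= r j]) p j) * (expR xi / 128).
  by rewrite ler_wpM2r ?divr_ge0 ?expR_ge0 // ltW.
by rewrite expRN; have e0 := expR_gt0 xi; (have -> : 128 * z / expR xi * (expR xi / 128) = z by field; lra).
Qed.

(** * Splitting the gain and bounding its parts *)

Let G := gain_sum p x y.

Lemma gain_noflip i c : gain p i false c <= 2 * p i.
Proof.
rewrite /gain mul0r sub0r; have := cgf_ge_lnC c (p01 i); have := lnC_ge (p12 i); lra.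
Qed.

Lemma gain_flip_mid w i : 0 <= w.2 -> J w < z -> i \in mid_class -> i \notin risky ->
  gain p i true (b i w) <= 2 * xi.
Proof.
move=> w2 Jz iM nr; have hx := xi2; rewrite /gain mul1r.
have [mxi|mxi] := leP xi (m i).
  have := not_risky_lt w2 Jz iM mxi nr.
  have [b0|b0] := leP 0 (b i w); first by have := cgf_ge0 (p01 i) b0; lra.
  by have := cgf_ge_id (p01 i) (ltW b0); lra.
have := cgf_ge_ln (b i w) (p01 i); have := ln_flip_rate_le (m0 i); rewrite -/(p i); lra.
Qed.

Definition predicted pi i := i \in sat_high pi.
(** Minus the logarithm of the probability that every saturated flip agrees with its prediction, as
    in [Pr_agree]. *)
Definition entropy pi :=
  \sum_(i in saturated pi) - ln (if predicted pi i then p i else 1 - p i).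

Lemma entropy_le w : 0 <= w.2 -> J w < z -> entropy (cell w) <= 64 * z.
Proof.
move=> w2 Jz; apply: (@le_trans _ _ (64 * J w)); last by have := Jz; lra.
apply: le_trans (_ : 64 * \sum_(i in saturated (cell w)) cgap (p i) (b i w) <= _); last first.
  by rewrite ler_wpM2l // gap_sub.
rewrite mulr_sumr; apply: ler_sum => i; rewrite in_setU /predicted => hi.
have hH := H4; case: ifP hi => [ih _|_]; last first.
  by rewrite orbF => /(sat_low_lt w2) hb; apply: sat_neg_gap; lra.
have := sat_high_gt ih; have := cap_ge1 i => c1 hb; apply: sat_pos_gap.
by apply: le_trans (ltW hb); rewrite ler_wpM2r //; lra.
Qed.

(** An agreeing flip gains at most its surprise; a disagreeing one loses a further [H = 64 * z],
    which by [entropy_le] outweighs the whole entropy. *)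
Lemma saturated_gain F w : 0 <= w.2 -> J w < z ->
  G (saturated (cell w)) F w <= entropy (cell w) /\
  ((exists2 i, i \in saturated (cell w) & F i != predicted (cell w) i) ->
   G (saturated (cell w)) F w <= 0).
Proof.
move=> w2 Jz; have hH := H4; have hz := z1.
have key i : i \in saturated (cell w) -> gain p i (F i) (b i w) <=
    - ln (if predicted (cell w) i then p i else 1 - p i)
    - H * (F i != predicted (cell w) i)%:R.
  rewrite in_setU /predicted /gain; case: ifP => [ih _|_].
    have := sat_high_gt ih; have := cap_ge1 i => c1 hb.
    have := cgf_ge_ln (b i w) (p01 i).
    have : H <= H * cap i by rewrite ler_peMr //; lra.
    by case: (F i); rewrite /= ?mulr0 ?mulr1 ?mul1r ?mul0r; lra.
  rewrite orbF => /(sat_low_lt w2) hb; have := cgf_ge_lnC (b i w) (p01 i).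
  by case: (F i); rewrite /= ?mulr0 ?mulr1 ?mul1r ?mul0r; lra.
have hs : G (saturated (cell w)) F w <= entropy (cell w) -
    H * \sum_(i in saturated (cell w)) (F i != predicted (cell w) i)%:R.
  by rewrite mulr_sumr -sumrB; apply: ler_sum.
have n0 (P : pred I) : 0 <= \sum_(i | P i) (F i != predicted (cell w) i)%:R :> R.
  by apply: sumr_ge0 => i _; rewrite ler0n.
split.
  by apply: le_trans hs _; rewrite gerBl mulr_ge0 //; lra.
case=> i iS ne; apply: le_trans hs _.
have : 1 <= \sum_(i in saturated (cell w)) (F i != predicted (cell w) i)%:R :> R.
  by rewrite (bigD1 i) //= ne lerDl.
move=> h1; have := entropy_le w2 Jz.
have : H * 1 <= H * \sum_(i in saturated (cell w)) (F i != predicted (cell w) i)%:R.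
  by rewrite ler_wpM2l //; lra.
rewrite /H; lra.
Qed.

Lemma blur_mid pi : blur pi \subset mid_class.
Proof. by apply/subsetP => i; rewrite in_set in_setD => /andP[/andP[_]]; rewrite in_set => /andP[]. Qed.

Lemma saturated_sub pi : saturated pi \subset (near_class :|: mid_class) :\: blur pi.
Proof.
apply/subsetP => i; rewrite in_setU => /orP[] h.
  have nb : i \notin blur pi by rewrite in_set in_setD h.
  rewrite in_setD nb in_setU; move: h; rewrite in_setU => /orP[].
    by rewrite in_set => /andP[/(subsetP X0_near) -> _].
  by rewrite in_set => /andP[]; rewrite in_set => /andP[->]; rewrite orbT.
have [nb hX] : i \notin blur pi /\ i \in X0 :|: Xp.
  by move: h; rewrite /sat_high in_setD => /andP[->]; rewrite in_set => /andP[->].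
by rewrite in_setD nb in_setU; move: hX; rewrite in_setU;
  case/orP => [/(subsetP X0_near) ->|/(subsetP Xp_mid) ->]; rewrite ?orbT.
Qed.

Lemma outcome_split F w (q : nat) : 0 <= w.2 -> J w < z -> z <= G [set: I] F w ->
  (forall i, i \in far_class -> ~~ F i) -> (forall i, i \in risky -> ~~ F i) ->
  (#|[set i in blur (cell w) | F i]| < q)%N ->
  2 * \sum_(i in far_class) p i + 2 * (K%:R * st) + 2 * q%:R * xi <= z / 4 ->
  (z / 4 <= entropy (cell w) /\
    forall i, i \in saturated (cell w) -> F i = predicted (cell w) i) \/
  z / 2 <= G (regular (cell w)) F w.
Proof.
move=> w2 Jz zG nfar nrisky hq budget; have hx := xi2.
set S := saturated (cell w); set B := blur (cell w).
have split : G [set: I] F w = G far_class F w + G B F w + G S F w + G (regular (cell w)) F w.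
  rewrite /G /gain_sum (big_setID far_class) setTI /= -!addrA; congr (_ + _).
  have -> : [set: I] :\: far_class = near_class :|: mid_class.
    apply/setP => i; rewrite in_setD in_setT !in_set andbT -ltNge.
    have [m1 /=|m1 //] := ltP (m i) 1.
    by apply: lt_le_trans m1 _; rewrite exprn_ege1 // ler1n.
  rewrite (big_setID B) /=; congr (_ + _).
    by apply: eq_bigl => i; rewrite in_setI andb_idl // => /(subsetP (blur_mid _)) iM; rewrite in_setU iM orbT.
  rewrite (big_setID S) /=; congr (_ + _).
    by apply: eq_bigl => i; rewrite in_setI andb_idl // => /(subsetP (saturated_sub _)).
  by apply: eq_bigl => i; rewrite setDDl (setUC B).
have gfar : G far_class F w <= 2 * \sum_(i in far_class) p i.
  rewrite mulr_sumr; apply: ler_sum => i iF; rewrite (negbTE (nfar _ iF)).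
  exact: gain_noflip.
have gB : G B F w <= 2 * (K%:R * st) + 2 * q%:R * xi.
  apply: (@le_trans _ _ (\sum_(i in B) (2 * p i + 2 * xi * (F i)%:R))).
    apply: ler_sum => i iB; have iM := subsetP (blur_mid _) _ iB.
    case Fi : (F i); rewrite /= ?mulr0 ?mulr1; last by have := gain_noflip i (proj x y i w); lra.
    have nr : i \notin risky by apply/negP => /nrisky; rewrite Fi.
    have := gain_flip_mid w2 Jz iM nr; have := p01 i; rewrite /b; lra.
  rewrite big_split /= -!mulr_sumr; apply: lerD.
    by rewrite ler_wpM2l // blur_mass.
  have -> : \sum_(i in B) (F i)%:R = #|[set i in B | F i]|%:R :> R.
    rewrite -sum1_card natr_sum big_mkcond [RHS]big_mkcond.
    by apply: eq_bigr => i _; rewrite in_set; case: (i \in B); case: (F i).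
  rewrite mulrAC ler_wpM2r //; first lra.
  by rewrite ler_wpM2l // ler_nat ltnW.
have [gS1 gS2] := saturated_gain F w2 Jz.
have hz := z1; rewrite -/S in gS1 gS2.
(* Far and blurred indices use at most [z / 4]. If the saturated ones contribute at most [z / 4] as
   well, the regular ones carry at least [z / 2]. *)
have [dis|agr] := pselect (exists2 i, i \in S & F i != predicted (cell w) i).
  by right; have := gS2 dis; lra.
have [e|e] := leP (z / 4) (entropy (cell w)); last by right; lra.
left; split => // i iS; apply/eqP; apply: contrapT => /negP ne.
by apply: agr; exists i.
Qed.

Lemma card_lines : (#|lines| <= 2 * #|X0| + #|Xp| + #|M|)%N.
Proof.
have : lines \subset [set (i, true) | i in X0 :|: Xp] :|: [set (i, false) | i in X0 :|: M].
  apply/subsetP => -[i []]; rewrite in_set /= => h; rewrite in_setU; apply/orP; [left|right];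
  exact: imset_f.
move/subset_leq_card => /leq_trans; apply.
apply: leq_trans (leq_card_setU _ _) _.
apply: leq_trans (leq_add (leq_imset_card _ _) (leq_imset_card _ _)) _.
apply: leq_trans (leq_add (leq_card_setU _ _) (leq_card_setU _ _)) _.
by rewrite mul2n -addnn addnACA addnA.
Qed.

(** Union bound: no far or risky index may flip; then for each pattern, either [q] flips fall in the
    blur, or predictions of large entropy all hold, or the regular part has a large gain inside its
    window. *)
Lemma Pr_half_plane (q N : nat) (lam : R) : 0 <= lam -> 32 * (16 * (16 * H)) <= N%:R ->
  2 * \sum_(i in far_class) p i + 2 * (K%:R * st) + 2 * q%:R * xi <= z / 4 ->
  Pr p (fun F => exists w, [/\ 0 <= w.2, J w < z & z <= G [set: I] F w]) <=
  \sum_(i in far_class) p i + K%:R * (128 * z * expR (- xi)) +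
  (#|lines|.+1 ^ 2)%:R *
   (expR (expR lam * (K%:R * st) - lam * q%:R) + expR (- (z / 4)) +
    (2 * N + 2)%:R ^+ 2 * expR (- (3 * z / 16))).
Proof.
move=> lam0 hN budget; have hz := z1; have hH := H4.
pose E1 (F : {ffun I -> bool}) := exists2 i, i \in far_class & F i.
pose E2 (F : {ffun I -> bool}) := exists2 i, i \in risky & F i.
pose A1 pi (F : {ffun I -> bool}) := (q <= #|[set i in blur pi | F i]|)%N.
pose A2 pi (F : {ffun I -> bool}) := z / 4 <= entropy pi /\
  forall i, i \in saturated pi -> F i = predicted pi i.
pose A3 pi (F : {ffun I -> bool}) := exists w,
  [/\ window cap x y (regular pi) H w, gap_sum p x y (regular pi) w < z &
      z / 2 <= G (regular pi) F w].
pose A pi F := A1 pi F \/ (A2 pi F \/ A3 pi F).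
pose P := patterns line0 line1 line2 (fun=> True) lines.
have step1 : Pr p (fun F => exists w, [/\ 0 <= w.2, J w < z & z <= G [set: I] F w]) <=
    Pr p (fun F => (E1 F \/ E2 F) \/ exists2 pi, pi \in P & A pi F).
  apply: Pr_le => // F [w [w2 Jz zG]].
  have [|n1] := pselect (E1 F); first by left; left.
  have [|n2] := pselect (E2 F); first by left; right.
  right; exists (cell w).
    by rewrite in_set; apply/asboolP; exists w.
  have [hq|hq] := leqP q #|[set i in blur (cell w) | F i]|; first by left.
  right; case: (outcome_split w2 Jz zG _ _ hq budget).
  - by move=> i iF; apply/negP => Fi; apply: n1; exists i.
  - by move=> i iF; apply/negP => Fi; apply: n2; exists i.
  - by left.
  move=> h; right; exists w; split => //; first exact: regular_window.
  exact: le_lt_trans (gap_sub _ _) Jz.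
apply: le_trans step1 _; apply: le_trans (Pr_or _ _ _) _ => //.
apply: lerD.
  apply: le_trans (Pr_or _ _ _) _ => //; apply: lerD; first exact: Pr_flip.
  by apply: le_trans (Pr_flip _ _) risky_mass.
apply: le_trans (Pr_exists _ _ _) _ => //.
have each pi : Pr p (A pi) <= expR (expR lam * (K%:R * st) - lam * q%:R) + expR (- (z / 4)) +
    (2 * N + 2)%:R ^+ 2 * expR (- (3 * z / 16)).
  apply: le_trans (Pr_or _ _ _) _ => //; rewrite -addrA; apply: lerD.
    apply: le_trans (Pr_flips_ge _ _ _ lam0) _ => //.
    by rewrite ler_expR lerB // ler_wpM2l ?expR_ge0 // blur_mass.
  apply: le_trans (Pr_or _ _ _) _ => //; apply: lerD.
    have [e|e] := leP (z / 4) (entropy pi).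
      apply: (@le_trans _ _ (Pr p (fun F => forall i, i \in saturated pi -> F i = predicted pi i))).
        by apply: Pr_le => // F [].
      by rewrite Pr_agree // ler_expR lerN2.
    have -> : Pr p (A2 pi) = 0.
      by rewrite /Pr big_pred0 // => F; apply/asboolP => -[]; rewrite leNgt e.
    exact: expR_ge0.
  (* The exponent of [Pr_window] at gain level [z / 2]. *)
  have -> : 3 * z / 16 = (z / 2) / 2 - z / 16 by field.
  apply: Pr_window => //; try lra.
  - by move=> i; apply: cap_flip_rate.
  - by move=> i; apply: flip_rate_cap.
have e0 : 0 <= expR (expR lam * (K%:R * st) - lam * q%:R) + expR (- (z / 4)) +
    (2 * N + 2)%:R ^+ 2 * expR (- (3 * z / 16)).
  by rewrite !addr_ge0 ?mulr_ge0 ?expR_ge0 ?sqr_ge0.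
apply: (@le_trans _ _ (\sum_(pi in P) (expR (expR lam * (K%:R * st) - lam * q%:R) + expR (- (z / 4)) +
    (2 * N + 2)%:R ^+ 2 * expR (- (3 * z / 16))))); first exact: ler_sum.
rewrite sumr_const -[leLHS]mulr_natl ler_wpM2r // ler_nat.
exact: card_patterns_plane.
Qed.

End Patterns.

(** * The tail bound over a half plane *)

Lemma dyadic_level (R : realType) (K : nat) (c : R) : 1 <= c < 2 ^+ K ->
  exists2 k, (k < K)%N & 2 ^+ k <= c < 2 ^+ k.+1.
Proof.
elim: K => [|K IH] /andP[c1 cK]; first by move: cK; rewrite expr0; lra.
have [h|h] := ltP c (2 ^+ K); last by exists K => //; rewrite h.
by have [|k kK hk] := IH; [rewrite c1 | exists k => //; rewrite ltnS ltnW].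
Qed.

Section Bound.
Variables (R : realType) (I : finType) (m x y : I -> R).
Hypothesis m0 : forall i, 0 <= m i.
Hypothesis xm : forall i, 1 <= m i -> x i = m i.
Let p i := flip_rate (m i).
Let b := proj x y.
Let J w := gap_sum p x y [set: I] w.
Let G F w := gain_sum p x y [set: I] F w.
Let r i := y i / m i.
Let p01 i : 0 < p i < 1.
Proof. by have := flip_rate_gt0 (m i); have := flip_rate_le (m0 i); rewrite /p => *; lra. Qed.

(** A spanning pair with coefficients in [-1, 1] dominates: a projection above [2 * H] forces one of
    the pair above [H]. *)
Lemma near_specials (H : R) (t : nat) (A : {set I}) : exists X : {set I},
  [/\ X \subset A, (#|X| <= 2 * t)%N & forall w i, i \in A :\: X -> 2 * H < `|b i w| ->
    (t <= #|[set j in X | `[< (H < `|b j w|)%R >]]|)%N].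
Proof.
apply: (dominating_rounds (W := R * R) (Q := fun i w => 2 * H < `|b i w|)
  (Q' := fun i w => H < `|b i w|)) => {}A A0.
have [a [c [aA cA span]]] := spanning_pair x y A0.
exists a, c; split=> // i w iA hi; have [al [be [hal hbe ex ey]]] := span i iA.
have [ha|ha] := ltP H `|b a w|; [by left | right].
rewrite ltNge; apply/negP => hc.
have e : b i w = al * b a w + be * b c w by rewrite /b /proj ex ey; ring.
have : `|b i w| <= `|b a w| + `|b c w|.
  rewrite e; apply: le_trans (ler_normD _ _) _; rewrite !normrM.
  by apply: lerD; rewrite ler_piMl.
lra.
Qed.

(** After division by [m i] the projection is [w.1 + r i * w.2], so on this half plane the index of
    largest [r] dominates alone. *)
Lemma mid_specials (H : R) (t : nat) (A : {set I}) : (forall i, i \in A -> 1 <= m i) ->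
  exists X : {set I},
  [/\ X \subset A, (#|X| <= 2 * t)%N & forall w i, i \in A :\: X -> 0 <= w.2 /\ H * m i < b i w ->
    (t <= #|[set j in X | `[< (H * m j < b j w)%R >]]|)%N].
Proof.
move=> Am.
have dom (B : {set I}) : B != set0 -> exists a c, [/\ a \in B, c \in B &
    forall i (w : R * R), i \in B -> [/\ 1 <= m i, 0 <= w.2 & H * m i < b i w] ->
    H * m a < b a w \/ H * m c < b c w].
  move=> B0; have [e|/(set_argmax r)[a]] := eqVneq [set i in B | 1 <= m i] set0.
    have /set0Pn[a aB] := B0; exists a, a; split => // i w iB [mi _].
    by have : i \in [set i in B | 1 <= m i]; [rewrite in_set iB | rewrite e in_set0].
  rewrite in_set => /andP[aB ma] ha; exists a, a; split => // i w iB [mi w2].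
  rewrite /b !(mid_proj y xm) // => hi; left; rewrite -/(r i) -/(r a) in hi *.
  have : r i <= r a by apply: ha; rewrite in_set iB.
  rewrite mulrC ltr_pM2l in hi; last lra.
  rewrite mulrC ltr_pM2l; last lra.
  by move=> h; apply: lt_le_trans hi _; rewrite lerD2l ler_wpM2r.
have [X [XA Xt hX]] := dominating_rounds dom t A.
exists X; split => // w i iX [w2 hi]; apply: hX (iX) _; split => //.
by apply: Am; move: iX; rewrite in_setD => /andP[].
Qed.

Lemma class_marks (z st : R) (K : nat) (lev : I -> nat) : 0 < st -> 0 <= z ->
  (forall i, 1 <= m i < 2 ^+ K -> (lev i < K)%N) ->
  let low := low_class m y z K lev in
  exists M : {set I}, [/\ M \subset low,
   (#|M| <= K * (Num.truncn (32 * z / st)).+2)%N &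
   forall k (B : {set I}), B \subset [set i in low | lev i == k] ->
     (forall a, a \in M -> lev a = k ->
     (forall i, i \in B -> r a < r i) \/ (forall i, i \in B -> r i < r a)) ->
     \sum_(i in B) p i <= st].
Proof.
move=> st0 z0 levK low.
have mk k : exists Mk : {set I}, [/\ Mk \subset [set i in low | lev i == k],
   (#|Mk| <= (Num.truncn (32 * z / st)).+2)%N &
   forall B : {set I}, B \subset [set i in low | lev i == k] ->
     (forall a, a \in Mk -> (forall i, i \in B -> r a < r i) \/ (forall i, i \in B -> r i < r a)) ->
     \sum_(i in B) p i <= st].
  apply: mass_marks => //.
  - lra.
  - by move=> i; have := p01 i; lra.
  move=> i; rewrite in_set => /andP[]; rewrite in_set => /andP[iM hm] /eqP li.
  apply: le_lt_trans hm; rewrite big_mkcond [leRHS]big_mkcond; apply: ler_sum => j _.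
  have pj := p01 j; rewrite -/(p j) -/(r i) -/(r j).
  case: ifP => [/andP[]|_]; last by case: ifP => // _; lra.
  rewrite in_set => /andP[]; rewrite in_set => /andP[jM _] lj rj.
  by rewrite jM li lj /= rj.
have [Mk hMk] := choice mk.
exists (\bigcup_(k < K) Mk k); split.
- apply/bigcupsP => k _; have [h _ _] := hMk k; apply: subset_trans h _.
  by apply/subsetP => i; rewrite in_set => /andP[].
- apply: (@leq_trans (\sum_(k < K) #|Mk k|)%N); last first.
    rewrite -[X in (_ <= X * _)%N]card_ord -sum_nat_const.
    by apply: leq_sum => k _; have [_ h _] := hMk k.
  elim/big_rec2: _ => [|k n A _ h]; first by rewrite cards0.
  by apply: leq_trans (leq_card_setU _ _) _; rewrite leq_add2l.
move=> k B BX hB.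
have [kK|kK] := ltnP k K.
  have [h1 _ h3] := hMk k; apply: h3 => // a aM; apply: hB.
    by apply/bigcupP; exists (Ordinal kK).
  by move/(subsetP h1): aM; rewrite in_set => /andP[_ /eqP].
rewrite big1 ?ltW // => i /(subsetP BX); rewrite in_set => /andP[].
rewrite in_set => /andP[iM _] /eqP li.
have : (lev i < K)%N by apply: levK; move: iM; rewrite in_set.
by rewrite li ltnNge kK.
Qed.

Lemma Pr_half_plane_bound (z xi st lam : R) (K t q N : nat) :
  1 <= z -> 2 <= xi -> 5 * (64 * z) <= t%:R -> 0 < st -> 0 <= lam ->
  32 * (16 * (16 * (64 * z))) <= N%:R ->
  2 * \sum_(i in far_class m K) p i + 2 * (K%:R * st) + 2 * q%:R * xi <= z / 4 ->
  Pr p (fun F => exists w, [/\ 0 <= w.2, J w < z & z <= G F w]) <=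
  \sum_(i in far_class m K) p i + K%:R * (128 * z * expR (- xi)) +
  ((6 * t + K * (Num.truncn (32 * z / st)).+2).+1 ^ 2)%:R *
   (expR (expR lam * (K%:R * st) - lam * q%:R) + expR (- (z / 4)) +
    (2 * N + 2)%:R ^+ 2 * expR (- (3 * z / 16))).
Proof.
move=> z1 xi2 ht st0 lam0 hN budget.
have lv i : exists k, 1 <= m i < 2 ^+ K -> (k < K)%N /\ 2 ^+ k <= m i < 2 ^+ k.+1.
  have [/dyadic_level[k kK hk]|h] := boolP (1 <= m i < 2 ^+ K); first by exists k.
  (* A dummy level outside the dyadic range. *)
  by exists 0%N.
have [lev levP] := choice lv.
have [X0 [X0n X0c X0d]] := near_specials (64 * z) t (near_class m).
have [Xp [Xpn Xpc Xpd]] : exists X : {set I},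
  [/\ X \subset mid_class m K, (#|X| <= 2 * t)%N & forall w i, i \in mid_class m K :\: X ->
    0 <= w.2 /\ 64 * z * m i < b i w ->
    (t <= #|[set j in X | `[< (64 * z * m j < b j w)%R >]]|)%N].
  by apply: mid_specials => i; rewrite in_set => /andP[].
have [M [Mn Mc Md]] := class_marks (z := z) (K := K) (lev := lev) st0 ltac:(lra)
  (fun i h => (levP i h).1).
have cl := card_lines X0 Xp M.
apply: le_trans (Pr_half_plane m0 xm z1 xi2 ht levP X0d X0n Xpn Xpd Mn Md lam0 hN budget) _.
rewrite lerD2l ler_wpM2r //.
rewrite ler_nat leq_exp2r // ltnS.
apply: leq_trans cl _.
have -> : (6 * t = 2 * (2 * t) + 2 * t)%N by rewrite mulnA -mulnDl.
by rewrite leq_add // leq_add // leq_mul.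
Qed.

(* The gain at [w / 2] is half the gain at [w] plus the gap at [w], so halving a
   point of large gap does not lose the gain. *)
Lemma exists_small_gap (z : R) F w : 0 < z -> 0 <= w.2 -> z <= G F w ->
  exists w', [/\ 0 <= w'.2, J w' < z & z <= G F w'].
Proof.
move=> z0 w2 zG; apply: contrapT => hn.
pose v (k : nat) : R * R := (w.1 / 2 ^+ k, w.2 / 2 ^+ k).
have p2 k : 0 < (2 : R) ^+ k by rewrite exprn_gt0.
have v2 k : 0 <= (v k).2 by rewrite /v /= divr_ge0 // ltW.
have all_big k : z <= G F (v k).
  elim: k => [|k IH].
    by have -> : v 0%N = w by rewrite /v expr0 !divr1; case: (w).
  have Jk : z <= J (v k).
    by rewrite leNgt; apply/negP => h; apply: hn; exists (v k).
  have half i : b i (v k.+1) = b i (v k) / 2.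
    by rewrite /b /proj /v /= exprS; field; have := p2 k; lra.
  have -> : G F (v k.+1) = G F (v k) / 2 + J (v k).
    rewrite /G /J /gain_sum /gap_sum mulr_suml -big_split; apply: eq_bigr => i _ /=.
    by rewrite -/b half /gain /cgap; field.
  lra.
pose Nb := \sum_i `|b i w|.
(* Gains tend to 0 along the halvings, which contradicts [all_big]. *)
have bound k : G F (v k) <= Nb / 2 ^+ k.
  rewrite /G /gain_sum /Nb mulr_suml big_mkcond; apply: ler_sum => i _.
  rewrite in_setT -/b.
  have -> : b i (v k) = b i w / 2 ^+ k.
    by rewrite /b /proj /v /=; field; have := p2 k; lra.
  have -> : `|b i w| / 2 ^+ k = `|b i w / 2 ^+ k|.
    by rewrite normrM normfV (gtr0_norm (p2 k)).
  set c := b i w / 2 ^+ k; rewrite /gain.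
  have h1 := ler_norm c; have h2 := ler_norm (- c); rewrite normrN in h2.
  have [c0|c0] := leP 0 c.
    have := cgf_ge0 (p01 i) c0; case: (F i); rewrite ?mul1r ?mul0r; lra.
  have := cgf_ge_id (p01 i) (ltW c0); case: (F i); rewrite ?mul1r ?mul0r; lra.
have [k hk] : exists k : nat, Nb < z * 2 ^+ k.
  exists (Num.truncn (Nb / z)).+1.
  rewrite mulrC -ltr_pdivrMr //; apply: lt_le_trans (truncnS_gt _) _.
  by rewrite -natrX ler_nat ltnW // ltn_expl.
have := all_big k; have := bound k.
rewrite ler_pdivlMr ?p2 //; have := p2 k; nra.
Qed.

End Bound.

(** * Parameters for the tail bound *)

Lemma expR_ge_monomial (R : realType) (A a : R) (k : nat) : 0 < a ->
  exists Z : R, forall z, Z <= z -> A * z ^+ k <= expR (a * z).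
Proof.
move=> a0; pose c := a ^+ k.+1 / k.+1`!%:R.
have c0 : 0 < c by rewrite divr_gt0 ?exprn_gt0 // ltr0n fact_gt0.
exists (Num.max 0 (A / c)) => z; rewrite ge_max => /andP[z0].
rewrite ler_pdivrMr // => hA.
apply: le_trans (expR_ge1Dxn k (_ : 0 <= a * z)); last by rewrite mulr_ge0 // ltW.
have -> : (a * z) ^+ k.+1 / k.+1`!%:R = (z * c) * z ^+ k.
  by rewrite /c exprMn (exprS z); set f := _^-1; set u := a ^+ _; ring.
have : A * z ^+ k <= (z * c) * z ^+ k by rewrite ler_wpM2r // exprn_ge0.
lra.
Qed.

(** With [E = expR e], the choices are [xi = 2 * e], [st = E ^- 2], [lam = e] and [q = 8]; [t] and
    [N] are linear in [z]. *)
Lemma half_plane_tail (R : realType) : exists Z A : R,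
  forall (I : finType) (m x y : I -> R) (e : R) (K : nat),
  (forall i, 0 <= m i) -> (forall i, 1 <= m i -> x i = m i) ->
  let z := 16 * (16 * e) in
  Z <= e -> K%:R <= expR e ->
  #|I|%:R * expR (- 2 ^+ K) <= expR (- z) ->
  Pr (fun i => flip_rate (m i)) (fun F => exists w, 0 <= w.2 /\
    z <= gain_sum (fun i => flip_rate (m i)) x y [set: I] F w) <= A * z ^+ 4 * expR (- e).
Proof.
have [D [D0 DE]] : exists D : R, 0 <= D /\ forall z, 32 * (16 * (16 * (64 * z))) = D * z.
  by exists (32 * (16 * (16 * 64))); split; [rewrite !mulr_ge0 ?ler0n | move=> z; rewrite -!mulrA].
have [D1 [D10 D1E]] : exists D : R, 0 <= D /\ forall z, 5 * (64 * z) = D * z.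
  by exists (5 * 64); split; [rewrite mulr_ge0 ?ler0n | move=> z; rewrite mulrA].
pose C2 : R := 6 * D1 + 41.
have C20 : 0 <= C2 by rewrite /C2; lra.
pose C1 : R := 2 * D + 4.
have C10 : 0 <= C1 by rewrite /C1; lra.
exists 1, (129 + C2 ^+ 2 * (5 + C1 ^+ 2)) => I m x y e K m0 xm; cbv zeta.
move ez : (16 * (16 * e)) => z e1 KE far_small.
have p01 i : 0 < flip_rate (m i) < 1.
  by have := flip_rate_gt0 (m i); have := flip_rate_le (m0 i); lra.
set p := fun i => flip_rate (m i).
set E := expR e.
have E0 : 0 < E by apply: expR_gt0.
have E1 : 1 <= E by rewrite /E leNgt expR_lt1 -leNgt; lra.
have EN k : expR (- (k%:R * e)) = E ^- k by rewrite expRN expRM_natl.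
have V0 : 0 < E^-1 by rewrite invr_gt0.
have V1 : E^-1 <= 1 by rewrite invf_le1.
have EVk j k : (j <= k)%N -> E ^- k <= E ^- j.
  by move=> jk; rewrite -!exprVn; apply: ler_wiXn2l => //; exact: ltW.
pose far := far_class m K.
have far_sum : \sum_(i in far) p i <= E^-1.
  have : \sum_(i in far) p i <= \sum_(i in [set: I]) expR (- 2 ^+ K).
    rewrite big_mkcond [leRHS]big_mkcond; apply: ler_sum => i _; rewrite in_setT.
    case: ifP => [|_]; last exact: expR_ge0.
    rewrite in_set => hm; apply: (@le_trans _ _ (expR (- m i))); last by rewrite ler_expR lerN2.
    rewrite expRN /p /flip_rate lef_pV2 ?posrE ?expR_gt0 //; have := expR_gt0 (m i); lra.
  rewrite sumr_const cardsT -[leRHS]mulr_natl => /le_trans; apply.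
  apply: le_trans far_small _.
  rewrite -ez mulrA -natrM EN -[leRHS]expr1 exprVn; exact: EVk.
have up (c : R) : 0 <= c -> exists k : nat, c <= k%:R /\ k%:R <= c + 1.
  move=> c0; exists (Num.truncn c).+1; split; first by rewrite ltW // truncnS_gt.
  by rewrite -natr1 lerD2r truncn_le.
have st0 : 0 < E ^- 2 by rewrite invr_gt0 exprn_gt0.
have lam0 : 0 <= e by lra.
have KV : K%:R * E ^- 2 <= E^-1.
  rewrite ler_pdivrMr ?exprn_gt0 // expr2 mulrA mulVf ?mul1r //.
  by rewrite gt_eqF.
have K0 : 0 <= K%:R :> R by [].
have budget : 2 * \sum_(i in far) p i + 2 * (K%:R * E ^- 2) + 2 * 8%:R * (2 * e) <= z / 4 by lra.
have z1 : 1 <= z by lra.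
have z0 : 0 <= z := le_trans ler01 z1.
have xi2 : 2 <= 2 * e by lra.
have [t [ht htu]] := up (D1 * z) ltac:(by rewrite mulr_ge0 //; lra).
have [N [hN hNu]] := up (D * z) ltac:(by rewrite mulr_ge0 //; lra).
rewrite -DE in hN; rewrite -D1E in ht.
have hmain := Pr_half_plane_bound y m0 xm z1 xi2 ht st0 lam0 hN budget.
clear ht hN DE D1E.
have event F : (exists w, 0 <= w.2 /\ z <= gain_sum p x y [set: I] F w) ->
  exists w, [/\ 0 <= w.2, gap_sum p x y [set: I] w < z & z <= gain_sum p x y [set: I] F w].
  by case=> w [w2 zG]; apply: (@exists_small_gap R I m x y m0 z F w) => //; lra.
apply: le_trans (Pr_le p01 event) _; apply: le_trans hmain _.
rewrite -/E -/p -/far.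
have -> : z / 4 = 64 * e by rewrite -ez; field.
have -> : 3 * z / 16 = 48 * e by rewrite -ez; field.
rewrite !EN.
have risk : K%:R * (128 * z * E ^- 2) <= 128 * z * E^-1.
  have -> : K%:R * (128 * z * E ^- 2) = 128 * z * (K%:R * E ^- 2) by ring.
  by rewrite ler_wpM2l //; lra.
have flips : expR (E * (K%:R * E ^- 2) - e * 8%:R) <= 4 * E ^- 8.
  have -> : E * (K%:R * E ^- 2) - e * 8%:R = E * (K%:R * E ^- 2) + - (8%:R * e) by ring.
  rewrite expRD EN ler_wpM2r ?invr_ge0 ?exprn_ge0 //; first exact: ltW.
  apply: le_trans (expR1_le4 R); rewrite ler_expR.
  have : E * (K%:R * E ^- 2) <= E * E^-1 by rewrite ler_pM2l.
  by rewrite divff // gt_eqF.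
have grid : (2 * N + 2)%:R ^+ 2 * E ^- 48 <= C1 ^+ 2 * z ^+ 2 * E ^- 8.
  rewrite -exprMn; apply: ler_pM; rewrite ?sqr_ge0 ?invr_ge0 ?exprn_ge0 //; try exact: ltW.
    rewrite ler_sqr ?nnegrE ?ler0n //; last by rewrite mulr_ge0 //; lra.
    by rewrite natrD natrM /C1; lra.
  exact: EVk.
(* There are at most [E] levels with [O(z * E ^+ 2)] marks each, hence [O(z * E ^+ 3)] lines and
   about [E ^+ 6] patterns; the terms of order [E ^- 8] absorb them. *)
have nlines : ((6 * t + K * (Num.truncn (32 * z / E ^- 2)).+2).+1 ^ 2)%:R <= (C2 * z * E ^+ 3) ^+ 2 :> R.
  rewrite natrX ler_sqr ?nnegrE ?ler0n //; last by rewrite !mulr_ge0 ?exprn_ge0 //; lra.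
  rewrite -natr1 natrD !natrM -addn2 natrD.
  have : (Num.truncn (32 * z / E ^- 2))%:R <= 32 * z * E ^+ 2 :> R.
    by rewrite invrK truncn_le // mulr_ge0 ?exprn_ge0 //; lra.
  set T : R := _%:R => hT; have T0 : 0 <= T by rewrite ler0n.
  have E2 : 1 <= E ^+ 2 by rewrite exprn_ege1.
  have E3 : 1 <= E ^+ 3 by rewrite exprn_ege1.
  have : D1 * z <= D1 * (z * E ^+ 3) by rewrite ler_wpM2l // ler_peMr //; lra.
  have : K%:R * (T + 2) <= E * (34 * z * E ^+ 2).
    by apply: ler_pM => //; [lra | nra].
  have -> : E * (34 * z * E ^+ 2) = 34 * (z * E ^+ 3) by ring.
  have : z <= z * E ^+ 3 by rewrite ler_peMr //; lra.
  rewrite /C2; lra.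
have V8 : E ^- 64 <= E ^- 8 by apply: EVk.
set n := _%:R in nlines *; set f := expR _ in flips *.
have n0 : 0 <= n by rewrite ler0n.
have V80 : 0 <= E ^- 8 by rewrite invr_ge0 exprn_ge0 // ltW.
have z2 : 1 <= z ^+ 2 by rewrite exprn_ege1 //; lra.
have prod : n * (f + E ^- 64 + (2 * N + 2)%:R ^+ 2 * E ^- 48) <=
   (C2 * z * E ^+ 3) ^+ 2 * ((5 + C1 ^+ 2) * z ^+ 2 * E ^- 8).
  apply: ler_pM => //.
    by rewrite !addr_ge0 ?mulr_ge0 ?expR_ge0 ?sqr_ge0 ?invr_ge0 ?exprn_ge0 // ltW.
  have : E ^- 8 <= z ^+ 2 * E ^- 8 by rewrite ler_peMl.
  lra.
have prod2 : (C2 * z * E ^+ 3) ^+ 2 * ((5 + C1 ^+ 2) * z ^+ 2 * E ^- 8) <=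
    C2 ^+ 2 * (5 + C1 ^+ 2) * z ^+ 4 * E^-1.
  have -> : (C2 * z * E ^+ 3) ^+ 2 * ((5 + C1 ^+ 2) * z ^+ 2 * E ^- 8) =
    C2 ^+ 2 * (5 + C1 ^+ 2) * z ^+ 4 * (E^-1 * E^-1) by field; rewrite gt_eqF.
  rewrite ler_wpM2l //; last by rewrite ler_piMl // ltW.
  apply: mulr_ge0; last exact: (exprn_ge0 4 z0).
  apply: mulr_ge0; first exact: sqr_ge0.
  by apply: addr_ge0; [exact: (ler0n R 5) | exact: sqr_ge0].
have z4 : z <= z ^+ 4 by apply: ler_eXnr => //; lra.
rewrite expRN -/E mulrDl mulrDl.
have : 129 * z * E^-1 <= 129 * z ^+ 4 * E^-1.
  by rewrite ler_wpM2r ?ler_wpM2l // ltW.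
have : E^-1 <= z * E^-1 by exact: (ler_peMl (ltW V0) z1).
lra.
Qed.

(** Reflecting [y] and [w.2] covers the other half plane; the polynomial factor is absorbed by half
    of the exponent. *)
Lemma plane_tail (R : realType) : exists Z : R,
  forall (I : finType) (m x y : I -> R) (e : R) (K : nat),
  (forall i, 0 <= m i) -> (forall i, 1 <= m i -> x i = m i) ->
  let z := 16 * (16 * e) in
  Z <= e -> K%:R <= expR e ->
  #|I|%:R * expR (- 2 ^+ K) <= expR (- z) ->
  Pr (fun i => flip_rate (m i)) (fun F => exists w,
    z <= gain_sum (fun i => flip_rate (m i)) x y [set: I] F w) <= expR (- (e / 2)).
Proof.
have [Z [A half]] := half_plane_tail R.
have c0 : 0 < (32 * 16)^-1 :> R by rewrite invr_gt0 mulr_gt0 ?ltr0n.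
have [Z' mono] := expR_ge_monomial (2 * A) 4 c0.
exists (Num.max Z (Num.max Z' 0)) => I m x y e K m0 xm z.
rewrite !ge_max => /and3P[Ze Ze' e0] KE far.
have p01 i : 0 < flip_rate (m i) < 1.
  by have := flip_rate_gt0 (m i); have := flip_rate_le (m0 i); lra.
have h1 := half I m x y e K m0 xm Ze KE far.
have h2 := half I m x (fun i => - y i) e K m0 xm Ze KE far.
set p := fun i => flip_rate (m i) in h1 h2 *.
have event F : (exists w, z <= gain_sum p x y [set: I] F w) ->
    (exists w, 0 <= w.2 /\ z <= gain_sum p x y [set: I] F w) \/
    (exists w, 0 <= w.2 /\ z <= gain_sum p x (fun i => - y i) [set: I] F w).
  case=> w hw; have [w2|w2] := leP 0 w.2; first by left; exists w.
  right; exists (w.1, - w.2); split; first by rewrite /= oppr_ge0 ltW.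
  apply: le_trans hw _; rewrite /gain_sum; apply: ler_sum => i _.
  by rewrite /proj /= mulrNN.
apply: le_trans (Pr_le p01 event) _; apply: le_trans (Pr_or p01 _ _) _.
apply: le_trans (lerD h1 h2) _.
have -> : - e = - (e / 2) + - (e / 2) by field.
rewrite expRD.
have := mono z _; have -> : (32 * 16)^-1 * z = e / 2 by rewrite /z; field.
have zZ' : Z' <= z by rewrite /z; lra.
move=> /(_ zZ') hm; have u0 := expR_gt0 (- (e / 2)).
have e1 : expR (e / 2) * expR (- (e / 2)) = 1 by rewrite expRxMexpNx_1.
set u := expR (- (e / 2)) in u0 e1 *.
have := ler_wpM2r (ltW u0) hm; rewrite e1 -/z.
move=> h3; have : (2 * A * z ^+ 4 * u) * u <= 1 * u by rewrite ler_wpM2r // ltW.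
by move: (z ^+ 4) h3 => w _ h4; clear -h4; lra.
Qed.

(** * From logistic labels to flips *)

Section Link.
Variables (R : realType) (n : nat) (x : 'I_n -> 'rV[R]_2) (th : 'rV[R]_2).

Definition margin i := `|dot (x i) th|.
Definition side i : R := if 0 <= dot (x i) th then 1 else -1.
Definition label i (f : bool) : R := if f then - side i else side i.

Lemma sideM i : side i * dot (x i) th = margin i.
Proof.
rewrite /side /margin; case: ifP => h; first by rewrite mul1r ger0_norm.
by rewrite mulN1r ler0_norm // ltW // ltNge h.
Qed.

Lemma dotE (u v : 'rV[R]_2) : dot u v = u ord0 ord0 * v ord0 ord0 + u ord0 1 * v ord0 1.
Proof.
rewrite /dot !big_ord_recl big_ord0 addr0; congr (_ + u _ _ * v _ _); exact: val_inj.
Qed.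

(* Coordinates along [th] and its orthogonal; if [th = 0] any basis will do. *)
Lemma margin_coordinates : exists xc yc : 'I_n -> R,
  (forall i, 1 <= margin i -> xc i = margin i) /\
  forall th', exists w, forall i, side i * (dot (x i) th - dot (x i) th') = proj xc yc i w.
Proof.
set t1 := th ord0 ord0; set t2 := th ord0 1.
have s0 : 0 <= t1 ^+ 2 + t2 ^+ 2 by rewrite addr_ge0 ?sqr_ge0.
have [e|ne] := eqVneq (t1 ^+ 2 + t2 ^+ 2) 0.
  move/eqP: e; rewrite paddr_eq0 ?sqr_ge0 // !sqrf_eq0 => /andP[/eqP t10 /eqP t20].
  exists (fun i => side i * x i ord0 ord0), (fun i => side i * x i ord0 1); split.
    move=> i; rewrite /margin dotE -/t1 -/t2 t10 t20 !mulr0 addr0 normr0; lra.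
  move=> th'; exists (t1 - th' ord0 ord0, t2 - th' ord0 1) => i.
  by rewrite !dotE /proj /= -/t1 -/t2; ring.
exists margin, (fun i => side i * (x i ord0 1 * t1 - x i ord0 ord0 * t2)); split => // th'.
pose a := t1 - th' ord0 ord0; pose b := t2 - th' ord0 1.
(* The components of [th - th'] along [th] and its quarter turn. *)
exists ((a * t1 + b * t2) / (t1 ^+ 2 + t2 ^+ 2), (b * t1 - a * t2) / (t1 ^+ 2 + t2 ^+ 2)) => i.
rewrite /proj /= -sideM !dotE -/t1 -/t2.
have -> : th' ord0 ord0 = t1 - a by rewrite /a; ring.
have -> : th' ord0 1 = t2 - b by rewrite /b; ring.
by field.
Qed.

Lemma sigmoid_gt0 (t : R) : 0 < sigmoid t.
Proof. by rewrite invr_gt0; have := expR_gt0 (- t); lra. Qed.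

Lemma sigmoid_le1 (t : R) : sigmoid t <= 1.
Proof. by rewrite invf_le1; have := expR_gt0 (- t); lra. Qed.

Lemma sigmoidN (t : R) : sigmoid (- t) = 1 - sigmoid t.
Proof.
rewrite /sigmoid opprK expRN; have := expR_gt0 t => h; field.
by apply/andP; split; rewrite gt_eqF //; lra.
Qed.

(** Moving the signed margin from [m] to [m - b] tilts the flip law by [b]; this identifies
    log-likelihood ratios with gains. *)
Lemma sigmoid_ratio (m b : R) (f : bool) : 0 <= m ->
  sigmoid ((if f then -1 else 1) * (m - b)) =
  expR (gain (fun=> flip_rate m) tt f b) * sigmoid ((if f then -1 else 1) * m).
Proof.
move=> m0; have em := expR_gt0 m; have eb := expR_gt0 b.
rewrite /gain expRB expR_cgf; last first.
  by have := flip_rate_gt0 m; have := flip_rate_le m0; lra.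
rewrite /flip_rate /sigmoid.
case: f; rewrite ?mulN1r ?mul1r ?mul0r ?expR0 ?opprK ?opprB ?expRB ?expRN; field;
  by repeat (apply/andP; split); rewrite gt_eqF //; lra.
Qed.

Let p i := flip_rate (margin i).

Lemma margin_ge0 i : 0 <= margin i. Proof. exact: normr_ge0. Qed.

Lemma likelihood_gain xc yc th' w (F : {ffun 'I_n -> bool}) :
  (forall i, side i * (dot (x i) th - dot (x i) th') = proj xc yc i w) ->
  logistic_likelihood x (fun i => label i (F i)) th' =
  expR (gain_sum p xc yc [set: 'I_n] F w) * logistic_likelihood x (fun i => label i (F i)) th.
Proof.
move=> hw; rewrite /logistic_likelihood /gain_sum expR_sum.
rewrite (eq_bigl xpredT); last by move=> i; rewrite in_setT.
rewrite -big_split; apply: eq_bigr => i _ /=.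
have lab f c : label i f * c = (if f then -1 else 1) * (side i * c).
  by rewrite /label; case: f; ring.
rewrite !lab sideM.
have -> : side i * dot (x i) th' = margin i - proj xc yc i w.
  by rewrite -hw mulrBr sideM; ring.
by rewrite sigmoid_ratio // margin_ge0.
Qed.

Lemma likelihood_gt0 (y : 'I_n -> R) th' : 0 < logistic_likelihood x y th'.
Proof. by apply: prodr_gt0 => i _; apply: sigmoid_gt0. Qed.

Lemma likelihood_le1 (y : 'I_n -> R) th' : logistic_likelihood x y th' <= 1.
Proof.
by apply: prodr_ile1 => i _; rewrite sigmoid_le1 ltW // sigmoid_gt0.
Qed.

(** The supremum need not be attained, as for separable data; the strict inequality supplies a
    parameter that already beats [B]. *)
Lemma llr_gt_gain xc yc (B : R) (F : {ffun 'I_n -> bool}) :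
  (forall th', exists w, forall i,
     side i * (dot (x i) th - dot (x i) th') = proj xc yc i w) ->
  B < log_likelihood_ratio th x (fun i => label i (F i)) ->
  exists w, B <= gain_sum p xc yc [set: 'I_n] F w.
Proof.
move=> hc; rewrite /log_likelihood_ratio.
set y := fun i => label i (F i); set L := logistic_likelihood x y th.
set S := sup _; have L0 : 0 < L := likelihood_gt0 y th.
have LS : L <= S.
  apply: ub_le_sup; last by exists th.
  by exists 1 => _ [th' _ <-]; apply: likelihood_le1.
have Q0 : 0 < S / L by rewrite divr_gt0 // (lt_le_trans L0 LS).
rewrite -{1}(expRK B) ltr_ln ?posrE ?expR_gt0 // ltr_pdivlMr // => hS.
have [|_ [th' _ <-]] := sup_gt _ hS; first by exists L, th.
have [w hw] := hc th'; rewrite (likelihood_gain _ hw) -/L ltr_pM2r // ltr_expR => /ltW hB.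
by exists w.
Qed.

End Link.

(** * Transfer to the probability space of the labels *)

Section Measure.
Variables (R : realType) (n : nat) (x : 'I_n -> 'rV[R]_2) (th : 'rV[R]_2).
Variables (d : measure_display) (T : measurableType d) (P : probability T R).
Variable Y : 'I_n -> {mfun T >-> R}.
Hypothesis hY : logistic_labels P x th Y.
Import classical_sets.
Local Open Scope classical_set_scope.

Let p i := flip_rate (margin x th i).
Let p01 i : 0 < p i < 1.
Proof.
have := flip_rate_gt0 (margin x th i); have := flip_rate_le (margin_ge0 x th i).
by rewrite /p; lra.
Qed.

Definition outcome (F : {ffun 'I_n -> bool}) : set T :=
  \bigcap_(i in [set` [set: 'I_n]%SET]) (Y i @^-1` [set label x th i (F i)]).

Let side_or i : side x th i = 1 \/ side x th i = -1.
Proof. by rewrite /side; case: ifP; [left | right]. Qed.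

Let measurable_label i c : measurable (Y i @^-1` [set c]).
Proof. by rewrite -[X in measurable X]setTI; apply: measurable_funP. Qed.

Lemma measurable_outcome F : measurable (outcome F).
Proof. by apply: fin_bigcap_measurable => // i _; apply: measurable_label. Qed.

Lemma label_prob i f : P (Y i @^-1` [set label x th i f]) = (if f then p i else 1 - p i)%:E.
Proof.
have [hpm _ hp1] := hY; have {hp1} := hp1 i.
have -> : [set w | Y i w = 1] = Y i @^-1` [set 1] by [].
move=> h1.
have hm1 : P (Y i @^-1` [set -1]) = (sigmoid (- dot (x i) th))%:E.
  have -> : Y i @^-1` [set -1] = ~` (Y i @^-1` [set 1]).
    apply/seteqP; split => w /=; last by case: (hpm i w).
    by move=> -> /eqP; rewrite -subr_eq0 -opprD oppr_eq0 -mulr2n pnatr_eq0.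
  by rewrite probability_setC // h1 sigmoidN EFinB.
have hs c : sigmoid (c * (side x th i * dot (x i) th)) = sigmoid (c * margin x th i).
  by rewrite sideM.
have e1 : sigmoid (margin x th i) = 1 - p i.
  by rewrite -[margin _ _ _]opprK sigmoidN /p /flip_rate /sigmoid opprK.
have e2 : sigmoid (- margin x th i) = p i by rewrite /p /flip_rate /sigmoid opprK.
have := hs 1; have := hs (-1); rewrite !mulN1r !mul1r /label => g1 g2.
by case: (side_or i) g1 g2 => -> g1 g2; case: f => /=; rewrite ?opprK ?h1 ?hm1; congr EFin;
  move: g1 g2; rewrite ?mul1r ?mulN1r ?opprK ?e1 ?e2.
Qed.

Lemma outcome_prob F : P (outcome F) = (flip_weight p F)%:E.
Proof.
have [_ ind _] := hY.
rewrite /outcome (ind [set: 'I_n]%SET (fun i => [set label x th i (F i)])); last first.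
  by move=> i; exact: measurable_set1.
rewrite /flip_weight -prodEFin; apply: eq_big => [i|i _]; first by rewrite finset.in_setT.
exact: label_prob.
Qed.

Lemma exists_outcome w :
  exists F : {ffun 'I_n -> bool}, (forall i, Y i w = label x th i (F i)) /\ outcome F w.
Proof.
have [hpm _ _] := hY.
pose F := [ffun i => Y i w != side x th i].
have hF i : Y i w = label x th i (F i).
  rewrite /F ffunE /label; case: eqVneq => //= ne.
  by case: (hpm i w) (side_or i) ne => -> [] -> //; rewrite ?eqxx ?opprK.
by exists F; split => // i _; exact: hF.
Qed.

Lemma quantile_llr_le (B delta : R) :
  (forall xc yc, (forall i, 1 <= margin x th i -> xc i = margin x th i) ->
     Pr p (fun F => exists w, B <= gain_sum p xc yc [set: 'I_n]%SET F w) <= delta) ->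
  (quantile P (1 - delta) (fun w => log_likelihood_ratio th x (fun i => Y i w)) <= B%:E)%E.
Proof.
move=> hB; have [xc [yc [hxc hc]]] := margin_coordinates x th.
apply: ereal_inf_lbound; exists B => //=.
set E := [set w | _ <= _].
pose good (F : {ffun 'I_n -> bool}) :=
  log_likelihood_ratio th x (fun i => label x th i (F i)) <= B.
have llrE w F : (forall i, Y i w = label x th i (F i)) ->
    log_likelihood_ratio th x (fun i => Y i w) =
    log_likelihood_ratio th x (fun i => label x th i (F i)).
  by move=> hF; congr log_likelihood_ratio; apply/funext.
(* The event depends on finitely many label outcomes, so its complement is a finite union of
   measurable sets, bounded by subadditivity. *)
pose U := \big[setU/set0]_(F | ~~ good F) outcome F.
have mU : measurable U by apply: bigsetU_measurable => F _; exact: measurable_outcome.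
have EU : E = ~` U.
  apply/seteqP; split => w.
    rewrite /E /= => wB; rewrite /U -bigcup_seq_cond => -[F /= /andP[_ nF] wF].
    move/negP: nF; apply; rewrite /good -(llrE w) // => i.
    by apply: wF; rewrite /= finset.in_setT.
  have [F [hF wF]] := exists_outcome w => nU; rewrite /E /= (llrE w F hF).
  apply: contrapT => /negP nF; apply: nU; rewrite /U -bigcup_seq_cond.
  by exists F => //=; rewrite mem_index_enum.
have PU : (P U <= (\sum_(F | ~~ good F) flip_weight p F)%:E)%E.
  rewrite -sumEFin /U.
  suff [] : measurable (\big[setU/set0]_(F | ~~ good F) outcome F) /\
    (P (\big[setU/set0]_(F | ~~ good F) outcome F) <=
      \sum_(F | ~~ good F) (flip_weight p F)%:E)%E by [].
  elim/big_rec2: _ => [|F s A _ [mA hA]]; first by rewrite measure0.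
  split; first by apply: measurableU => //; exact: measurable_outcome.
  apply: le_trans (measureU2 _ _ _) _ => //; first exact: measurable_outcome.
  by rewrite -outcome_prob leeD.
rewrite EU probability_setC // EFinB leeB //.
apply: le_trans PU _; rewrite lee_fin; apply: le_trans (hB xc yc hxc).
rewrite /Pr big_mkcond [leRHS]big_mkcond; apply: ler_sum => F _.
have w0 := flip_weight_ge0 p01 F.
case: ifP => [nF|_]; last by case: ifP.
rewrite asboolT //; apply: (llr_gt_gain hc).
by rewrite ltNge.
Qed.

End Measure.

(** * Choice of the constants *)

Lemma ln_ge1V (R : realType) (x : R) : 0 < x -> 1 - x^-1 <= ln x.
Proof.
move=> x0; have h : ln x^-1 <= x^-1 - 1.
  have := @le_ln1Dx R (x^-1 - 1); rewrite [1 + _]addrC subrK; apply.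
  by rewrite ltrBrDr addNr invr_gt0.
by move: h; rewrite lnV ?posrE //; lra.
Qed.

Lemma ln2_ge (R : realType) : 3 / 5 <= ln 2 :> R.
Proof.
have h : ln (5 / 4 : R) >= 1 / 5.
  by have := @ln_ge1V R (5 / 4) ltac:(lra); lra.
have h3 : (5 / 4 : R) ^+ 3 <= 2 by lra.
have : ln ((5 / 4 : R) ^+ 3) <= ln 2.
  by apply: ler_wpM2l || rewrite ler_ln ?posrE ?exprn_gt0 //; lra.
by rewrite lnXn; [lra | lra].
Qed.

(** The bound [- (3 / 4)] ensures that [ln (ln (ln n)) + L] is at least [L / 4] whenever
    [L >= 1]. *)
Lemma lnlnln_ge (R : realType) (n : nat) : (16 <= n)%N ->
  [/\ 1 <= ln n%:R :> R, 0 < ln (ln n%:R) :> R & - (3 / 4) <= ln (ln (ln n%:R)) :> R].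
Proof.
move=> n16; have h2 := ln2_ge R.
have h : 12 / 5 <= ln n%:R :> R.
  have : ln (16%:R : R) <= ln n%:R by rewrite ler_ln ?posrE ?ltr0n ?ler_nat; lia.
  have -> : 16%:R = 2 ^+ 4 :> R by rewrite -natrX.
  by rewrite lnXn ?ltr0n //; lra.
have ll : 7 / 12 <= ln (ln n%:R) :> R.
  have := @ln_ge1V R (ln n%:R) ltac:(lra).
  have : (ln n%:R)^-1 <= (12 / 5)^-1 :> R by rewrite lef_pV2 ?posrE; lra.
  by lra.
split; [lra | lra |].
have := @ln_ge1V R (ln (ln n%:R)) ltac:(lra).
have : (ln (ln n%:R))^-1 <= (7 / 12)^-1 :> R by rewrite lef_pV2 ?posrE; lra.
by lra.
Qed.

Lemma ln_add_le (R : realType) (a z : R) : 1 <= a -> 0 <= z -> ln (a + z) <= ln a + z.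
Proof.
move=> a1 z0.
have -> : a + z = a * (1 + z / a) by rewrite mulrDr mulr1 mulrCA divff ?mulr1 //; lra.
have za : 0 <= z / a by apply: divr_ge0 => //; lra.
rewrite lnM ?posrE; [|lra|lra].
apply: lerD => //; have := @le_ln1Dx R (z / a) ltac:(lra).
have : z / a <= z by rewrite ler_pdivrMr; [nra|lra].
by lra.
Qed.

(* With [z = 16 * (16 * e)], [2 ^ K >= ln n + z] makes the
   [n] atoms of size [expR (- 2 ^ K)] negligible. *)
Lemma level_count (R : realType) : exists Z : R, forall (n : nat) (e : R),
  Z <= e -> 1 <= ln n%:R :> R -> (0 < n)%N -> ln (ln n%:R) <= expR (e / 2) ->
  exists K : nat, K%:R <= expR e /\ n%:R * expR (- 2 ^+ K) <= expR (- (16 * (16 * e))).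
Proof.
have [Z1 hZ1] := @expR_ge_monomial R (2 * (2 * (16 * 16) + 1) * 2) 1 1 ltr01.
exists (Order.max Z1 6) => n e; rewrite ge_max => /andP[eZ e6] ln1 n0 hll.
move ez : (16 * (16 * e)) => z; have z1 : 1 <= z by lra.
pose Q : R := ln n%:R + z.
have Q1 : 1 <= Q by rewrite /Q; lra.
have lQ0 : 0 <= ln Q by apply: ln_ge0.
(* The factor 2 exceeds [1 / ln 2], so [2 ^+ K] is at least [Q]. *)
have [K [k1 k2]] : exists K : nat, 2 * ln Q < K%:R /\ K%:R <= 2 * ln Q + 1.
  exists (Num.truncn (2 * ln Q)).+1.
  have /andP[k1 k2] : (Num.truncn (2 * ln Q))%:R <= 2 * ln Q < (Num.truncn (2 * ln Q)).+1%:R.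
    by apply: truncn_itv; lra.
  by split => //; rewrite -natr1 lerD2r.
exists K.
have lnQ := ln_add_le ln1 (le_trans ler01 z1).
rewrite -/Q in lnQ.
split.
  have e1 : expR e = expR (e / 2) * expR (e / 2) by rewrite -expRD; congr expR; lra.
  have e2 : 1 + e / 2 <= expR (e / 2) by exact: expR_ge1Dx.
  have := hZ1 e eZ; rewrite expr1 mul1r => e3.
  have e4 : 4 * expR (e / 2) <= expR (e / 2) * expR (e / 2).
    by rewrite ler_wpM2r ?expR_ge0 //; lra.
  move: e3; rewrite e1 => e3.
  by lra.
have n0R : 0 < n%:R :> R by rewrite ltr0n.
rewrite -[X in X * _](lnK (x := n%:R)) ?posrE // -expRD ler_expR.
suff : Q <= 2 ^+ K by rewrite /Q; move: (2 ^+ K) => q; lra.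
have h2 := ln2_ge R.
rewrite -[leLHS](lnK (x := Q)) ?posrE; last by lra.
have -> : 2 ^+ K = expR (K%:R * ln 2) :> R.
  by rewrite expRM_natl lnK ?posrE ?ltr0n.
rewrite ler_expR.
have : K%:R * (3 / 5) <= K%:R * ln 2 :> R by rewrite ler_wpM2l ?ler0n.
by lra.
Qed.

Import numFieldNormedType.Exports.
Import classical_sets.
Local Open Scope classical_set_scope.
Local Open Scope ring_scope.

(* The labels Y are fixed measurable functions on a sample space T, and P x theta
   is the law under which they follow the logistic model with design x and
   parameter theta; T and the family P are arbitrary. *)
Theorem theoremA1 (R : realType) :
  exists C : R, 0 < C /\
    forall (n : nat) (delta : R),
      (16 <= n)%N -> 0 < delta -> delta <= (expR 1)^-1 ->
    forall (d : measure_display) (T : measurableType d)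
      (P : ('I_n -> 'rV[R]_2) -> 'rV[R]_2 -> probability T R)
      (Y : 'I_n -> {mfun T >-> R}),
      (forall x theta_star, logistic_labels (P x theta_star) x theta_star Y) ->
      (ereal_sup [set ereal_sup [set
           quantile (P x theta_star) (1 - delta)
             (fun w => log_likelihood_ratio theta_star x (fun i => Y i w))
         | theta_star in [set: 'rV[R]_2]] | x in [set: 'I_n -> 'rV[R]_2]]
       <= (C * (ln (ln (ln n%:R)) + ln (1 / delta)))%:E)%E.
Proof.
have [Z1 hZ1] := plane_tail R; have [Z2 hZ2] := level_count R.
(* Since [e >= D * (L / 4)] with [L >= 1], the multiples of 4 give [e >= Z1] and [e >= Z2], and 8
   gives [e >= 2 * L], that is, [expR (- (e / 2)) <= delta]. *)
pose D : R := Order.max 8 (Order.max (4 * Z1) (4 * Z2)).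
have [D1 D2 D3] : [/\ 8 <= D, 4 * Z1 <= D & 4 * Z2 <= D].
  by rewrite /D; split; rewrite !le_max lexx ?orbT.
move: D D1 D2 D3 => D D1 D2 D3.
exists (16 * (16 * D)); split=> [|n delta n16 d0 d1 d T P Y hY]; first by lra.
have [l1 ll0 l3] := lnlnln_ge R n16.
(* The target becomes [16 * (16 * e)], the gain level of [plane_tail]. *)
rewrite -2!mulrA; set L := ln (1 / delta); set e := D * _.
have LE : expR (- L) = delta by rewrite /L div1r lnV ?posrE // opprK lnK.
have L1 : 1 <= L.
  by move: d1; rewrite -expRN -[X in X <= _]LE ler_expR; lra.
have eL : D * (L / 4) <= e by rewrite /e ler_wpM2l //; lra.
have L4 : D * (1 / 4) <= D * (L / 4) by rewrite ler_wpM2l //; lra.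
have DL : 2 * L <= D * (L / 4) by nra.
have le : ln (ln n%:R) <= expR (e / 2).
  rewrite -[leLHS]lnK ?posrE // ler_expR.
  have : 2 * ln (ln (ln n%:R)) <= D * (ln (ln (ln n%:R)) + L) by nra.
  by rewrite -/e; lra.
have [e1 e2 e3] : [/\ Z1 <= e, Z2 <= e & 2 * L <= e] by split; lra.
have [K [K1 K2]] : exists K : nat,
    K%:R <= expR e /\ n%:R * expR (- 2 ^+ K) <= expR (- (16 * (16 * e))).
  apply: hZ2 e2 l1 _ le; exact: leq_trans n16.
apply: ge_ereal_sup => _ [x _ <-]; apply: ge_ereal_sup => _ [th _ <-].
apply: (quantile_llr_le (hY x th)) => xc yc hxc.
have ed : expR (- (e / 2)) <= delta by rewrite -LE ler_expR lerN2 ler_pdivlMr // mulrC.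
apply: le_trans ed; apply: (hZ1 _ _ _ _ _ K) => //; first exact: margin_ge0.
by rewrite card_ord.
Qed.
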